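(* Let $\mathbb{P}$ be the set of $m\times m$ positive definite Hermitian matrices with the trace metric, let $n\geq 2$, and let $\mathbf{w}=(w_1,\ldots,w_n)$ be a weight. Then the least squares mean $\mathfrak{G}_n(\mathbf{w};\cdot):\mathbb{P}^n\to\mathbb{P}$ is jointly concave: for all $(A_1,\ldots,A_n),(B_1,\ldots,B_n)\in\mathbb{P}^n$ and $0\leq t\leq 1$, $$t\,\mathfrak{G}_n(\mathbf{w};A_1,\ldots,A_n)+(1-t)\,\mathfrak{G}_n(\mathbf{w};B_1,\ldots,B_n)\leq \mathfrak{G}_n(\mathbf{w};tA_1+(1-t)B_1,\ldots,tA_n+(1-t)B_n).$$
   Context: The order is the Loewner order: $A\leq B$ iff $B-A$ is positive semidefinite. The trace metric on $\mathbb{P}$ is $\delta(A,B)=\left(\sum_{i=1}^{m}\log^2\lambda_i(A^{-1}B)\right)^{1/2}$, where $\lambda_1(X),\ldots,\lambda_m(X)$ are the eigenvalues of $X$ counted with multiplicity. A weight is a tuple $\mathbf{w}=(w_1,\ldots,w_n)$ of positive real numbers with $\sum_{i=1}^n w_i=1$. The (weighted) least squares mean of $(A_1,\ldots,A_n)\in\mathbb{P}^n$ is $\mathfrak{G}_n(\mathbf{w};A_1,\ldots,A_n)=\arg\min_{X\in\mathbb{P}}\sum_{i=1}^n w_i\delta^2(X,A_i)$; the minimizer exists and is unique (known fact). *)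

(* Defs.v *)
From HB Require Import structures.
From mathcomp Require Import all_boot all_order all_algebra.
From mathcomp Require Import complex.
From mathcomp Require Import boolp classical_sets reals sequences exp.

Set Implicit Arguments.
Unset Strict Implicit.
Unset Printing Implicit Defensive.

Import Order.TTheory GRing.Theory Num.Theory.
Local Open Scope classical_set_scope.
Local Open Scope ring_scope.
Local Open Scope complex_scope.
Local Open Scope sesquilinear_scope.

Section LeastSquaresMean.
Context {R : realType} {m : nat}.
Implicit Types A B X : 'M[R[i]]_m.

(* In the order of [R[i]], [0 <= z] (resp. [0 < z]) says that [z] is real and
   nonnegative (resp. positive). *)
Definition posdefmx : set 'M[R[i]]_m :=
  [set A | A \is hermsymmx /\
           forall x : 'cV[R[i]]_m, x != 0 -> 0 < (x ^t* *m A *m x) 0 0].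

Definition possemidefmx : set 'M[R[i]]_m :=
  [set A | A \is hermsymmx /\
           forall x : 'cV[R[i]]_m, 0 <= (x ^t* *m A *m x) 0 0].

Definition loewner_le A B : Prop := possemidefmx (B - A).

(* The roots of the characteristic polynomial, listed with multiplicity. *)
Definition eigenvalues X : seq R[i] :=
  sval (closed_field_poly_normal (char_poly X)).

Lemma eigenvaluesP X :
  char_poly X = \prod_(z <- eigenvalues X) ('X - z%:P).
Proof.
rewrite /eigenvalues; case: closed_field_poly_normal => r /= {1}->.
by rewrite (monicP (char_poly_monic X)) scale1r.
Qed.

(* For positive definite [A] and [B] the eigenvalues of [A^-1 B] are positive
   reals, so that taking real parts loses nothing. *)
Definition trace_dist A B : R :=
  Num.sqrt (\sum_(z <- eigenvalues (invmx A *m B)) ln (complex.Re z) ^+ 2).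

Context {n : nat}.
Implicit Types (w : 'I_n -> R) (As : 'I_n -> 'M[R[i]]_m).

Definition weight w : Prop := (forall i, 0 < w i) /\ \sum_i w i = 1.

Definition lscost w As X : R := \sum_i w i * trace_dist X (As i) ^+ 2.

Definition lsminimizers w As : set 'M[R[i]]_m :=
  [set X | posdefmx X /\ forall Y, posdefmx Y -> lscost w As X <= lscost w As Y].

(* The arg min over the positive definite matrices. The default [1%:M] is
   irrelevant: for a weight and positive definite [As], [lsminimizers w As] is
   a singleton. *)
Definition lsmean w As : 'M[R[i]]_m := xget 1%:M (lsminimizers w As).

End LeastSquaresMean.

Notation "A <=L B" := (loewner_le A B) (at level 70, no associativity).

(* Main.v *)
Require Import Defs.
From mathcomp Require Import all_boot all_order all_algebra.
From mathcomp Require Import complex ring lra.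
From mathcomp Require Import boolp classical_sets reals topology normedtype sequences exp.

(** * Joint concavity of the least squares mean

    Write [X = S S*] and [C = S D S*] with one invertible [S] and a positive
    diagonal [D] ([jdiag]).  The relative operator entropy of [X] and [C] is then
    [S (ln D) S*], and [X] minimizes the weighted cost of [C_1, ..., C_n] exactly
    when the weighted sum of the relative entropies of [X] and the [C_i] vanishes
    (the Karcher equation, [karcher]).  Relative entropy is the perspective of the
    operator concave function [ln], hence jointly concave; so if [X] and [Y] solve
    the Karcher equations of [A] and [B], then [Z = t X + (1 - t) Y] has nonnegative
    weighted entropy with respect to the [C_i = t A_i + (1 - t) B_i].  What remains
    is a comparison principle: nonnegative weighted entropy at [Z] forces [Z] to lie
    below the mean of the [C_i].

    Entropies enter only through quadratic forms [qf M x] and rational functions of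
    matrices.  The logarithm is approximated from above by left
    Riemann sums of its integral representation ([riemann_log]); on matrices these
    are positive combinations of weighted harmonic means minus [X] ([qentropy]).
    The form of a harmonic mean at [x] is a minimum of a linear expression in
    [(X, C)] over the decompositions of [x] ([hmean_le], [hmean_attained]); this one
    fact makes it monotone, jointly concave, and continuous along decreasing
    sequences.  Nonnegativity of the [N]-th approximate entropy of [X] means that
    [X] lies below [hstep N C X], a monotone map.  Iterating that map downwards from
    an upper bound of the [C_i] and [Z] yields the greatest such [X] below that bound
    ([greatest_fixpoint]), and it lies above [Z].  For [N = 2 ^ k] the approximations
    decrease, hence so do these greatest fixed points; their limit is above [Z] and
    solves the Karcher equation ([karcher_exists]).  Applied to a small multiple of the identity, the same lemma
    gives existence of solutions.

    That a Karcher solution is the unique minimizer ([karcher_cost]) follows, after a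
    congruence taking it to the identity, from the exponential metric increasing
    property [| log Y - log A |_F <= trace_dist Y A] ([exp_metric_increasing]): the
    Frobenius variance identity leaves the cost at [Y] larger than at the identity by
    at least [| log Y |_F ^ 2].  The property itself is proved by an infinitesimal
    estimate summed along a geodesic.  With eigenbases of [A] and [B], and [K] the
    unitary change of basis, [| log A - log B |_F ^ 2] is
    [sum (ln a_i - ln b_j) ^ 2 |K_ij| ^ 2], while
    [tr (A^-1 B) + tr (B^-1 A) - 2 m] is
    [sum (b_j / a_i + a_i / b_j - 2) |K_ij| ^ 2], and [u ^ 2 <= e^u + e^-u - 2]
    ([fnorm2_hlogB]).  Between neighbours at distance [1 / N] on a geodesic the latter
    quantity is [sum (l_i / N) ^ 2] to leading order, [l_i] being the logarithms of
    the eigenvalues of [Y^-1 A], and adding the [N] steps gives the claim in the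
    limit. *)

Set Implicit Arguments.
Unset Strict Implicit.
Unset Printing Implicit Defensive.
Import Order.TTheory GRing.Theory Num.Theory.
Import numFieldNormedType.Exports.
Local Open Scope ring_scope.
Local Open Scope complex_scope.
Local Open Scope sesquilinear_scope.
Local Open Scope classical_set_scope.

(** * Matrices and quadratic forms *)

Lemma invmx_uniq (F : fieldType) m (A B : 'M[F]_m) : A *m B = 1%:M -> invmx A = B.
Proof. by move=> AB; have [uA _] := mulmx1_unit AB; rewrite -[LHS]mulmx1 -AB mulKmx. Qed.

Lemma invmx_mul (F : fieldType) m (A B : 'M[F]_m) : A \in unitmx -> B \in unitmx ->
  invmx (A *m B) = invmx B *m invmx A.
Proof. by move=> uA uB; apply: invmx_uniq; rewrite mulmxA mulmxK// mulmxV. Qed.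

Lemma char_poly_similar (F : fieldType) m (T D : 'M[F]_m) : T \in unitmx ->
  char_poly (invmx T *m D *m T) = char_poly D.
Proof.
move=> uT; rewrite /char_poly /char_poly_mx !map_mxM map_invmx.
have uP : map_mx polyC T \in unitmx by rewrite map_unitmx.
have -> : 'X%:M = invmx (map_mx polyC T) *m 'X%:M *m map_mx polyC T.
  by rewrite scalar_mxC mulmxKV.
rewrite -mulmxBl -mulmxBr !det_mulmx mulrAC -det_mulmx mulVmx// det1 mul1r.
by rewrite scalar_mxC mulmxKV.
Qed.

Lemma mul_conj_inv (F : fieldType) m (S E G T : 'M[F]_m) : T \in unitmx ->
  (S *m E *m T) *m (invmx T *m G *m T) = S *m (E *m G) *m T.
Proof. by move=> uT; rewrite !mulmxA mulmxK. Qed.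

Section QuadraticForms.
Context {R : realType}.

Definition sqnorm (z : R[i]) : R := complex.Re z ^+ 2 + complex.Im z ^+ 2.

Lemma sqnorm_ge0 z : 0 <= sqnorm z.
Proof. by rewrite addr_ge0 ?sqr_ge0. Qed.

Lemma conjM_sqnorm (z : R[i]) : (z^* * z = (sqnorm z)%:C)%R.
Proof.
by case: z => a b; apply/eqP; rewrite eq_complex /sqnorm/=; apply/andP; split; apply/eqP; ring.
Qed.

Lemma Re_sum I (r : seq I) (P : pred I) (F : I -> R[i]) :
  complex.Re (\sum_(i <- r | P i) F i) = \sum_(i <- r | P i) complex.Re (F i).
Proof.
elim/big_rec2: _ => // i y1 y2 _ <-.
by case: (F i) => a b; case: y2.
Qed.

Lemma ReD (x y : R[i]) : complex.Re (x + y) = complex.Re x + complex.Re y.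
Proof. by case: x; case: y. Qed.

Lemma ReN (x : R[i]) : complex.Re (- x) = - complex.Re x.
Proof. by case: x. Qed.

Lemma ReCM (a : R) (x : R[i]) : complex.Re (a%:C * x) = a * complex.Re x.
Proof. by case: x => b c /=; rewrite mul0r subr0. Qed.

Lemma trmxCM m n p (A : 'M[R[i]]_(m, n)) (B : 'M_(n, p)) :
  (A *m B)^t* = B^t* *m A^t*.
Proof. by rewrite trmx_mul map_mxM. Qed.

Lemma trmxCD m n (A B : 'M[R[i]]_(m, n)) : (A + B)^t* = A^t* + B^t*.
Proof. by apply/matrixP=> i j; rewrite !mxE rmorphD. Qed.

Lemma trmxCN m n (A : 'M[R[i]]_(m, n)) : (- A)^t* = - A^t*.
Proof. by apply/matrixP=> i j; rewrite !mxE rmorphN. Qed.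

Lemma trmxCZ m n (a : R) (A : 'M[R[i]]_(m, n)) : (a%:C *: A)^t* = a%:C *: A^t*.
Proof.
by apply/matrixP=> i j; rewrite !mxE rmorphM; congr (_ * _)%R; exact: conjc_real.
Qed.

Lemma trmxC_sum m n I (r : seq I) (P : pred I) (F : I -> 'M[R[i]]_(m, n)) :
  (\sum_(i <- r | P i) F i)^t* = \sum_(i <- r | P i) (F i)^t*.
Proof.
by apply/matrixP=> i j; rewrite !mxE !summxE rmorph_sum; apply: eq_bigr => k _; rewrite !mxE.
Qed.

Context {m : nat}.
Implicit Types (A B M X : 'M[R[i]]_m) (x y : 'cV[R[i]]_m) (d : 'I_m -> R).

Lemma hermP M : (M \is hermsymmx) <-> M^t* = M.
Proof.
by split=> [/is_hermitianmxP|H]; [rewrite expr0 scale1r => <-|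
  apply/is_hermitianmxP; rewrite expr0 scale1r H].
Qed.

Definition qf M x : R := complex.Re ((x^t* *m M *m x) 0 0).

Lemma qfD A B x : qf (A + B) x = qf A x + qf B x.
Proof. by rewrite /qf mulmxDr mulmxDl mxE ReD. Qed.

Lemma qfZ (a : R) A x : qf (a%:C *: A) x = a * qf A x.
Proof. by rewrite /qf -scalemxAr -scalemxAl mxE ReCM. Qed.

Lemma qfN A x : qf (- A) x = - qf A x.
Proof. by rewrite /qf mulmxN mulNmx mxE ReN. Qed.

Lemma qfB A B x : qf (A - B) x = qf A x - qf B x.
Proof. by rewrite qfD qfN. Qed.

Lemma qf_sum I (r : seq I) (P : pred I) (F : I -> 'M_m) x :
  qf (\sum_(i <- r | P i) F i) x = \sum_(i <- r | P i) qf (F i) x.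
Proof. by rewrite /qf mulmx_sumr mulmx_suml summxE Re_sum. Qed.

Lemma qf_congr (S M : 'M_m) x : qf (S *m M *m S^t*) x = qf M (S^t* *m x).
Proof. by rewrite /qf trmxCM trmxCK !mulmxA. Qed.

Definition rdiag d : 'M[R[i]]_m := diag_mx (\row_i (d i)%:C).

Lemma rdiag_tr d : (rdiag d)^t* = rdiag d.
Proof.
rewrite /rdiag tr_diag_mx map_diag_mx; congr diag_mx.
by apply/rowP => i; rewrite !mxE -[LHS]/(conjc _) conjc_real.
Qed.

Lemma rdiagM d e : rdiag d *m rdiag e = rdiag (fun i => d i * e i).
Proof.
rewrite mulmx_diag; congr diag_mx; apply/rowP => i.
by rewrite !mxE -rmorphM.
Qed.

Lemma rdiag1 : rdiag (fun=> 1) = 1%:M.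
Proof. by rewrite -diag_const_mx; congr diag_mx; apply/rowP=> i; rewrite !mxE. Qed.

Lemma rdiagD d e : rdiag d + rdiag e = rdiag (fun i => d i + e i).
Proof.
rewrite /rdiag -linearD; congr diag_mx; apply/rowP=> i; by rewrite !mxE -rmorphD.
Qed.

Lemma rdiagZ (a : R) d : a%:C *: rdiag d = rdiag (fun i => a * d i).
Proof.
rewrite /rdiag -linearZ; congr diag_mx; apply/rowP=> i; by rewrite !mxE -rmorphM.
Qed.

Lemma rdiag_eq d e : d =1 e -> rdiag d = rdiag e.
Proof. by move=> de; congr diag_mx; apply/rowP=> i; rewrite !mxE de. Qed.

Lemma rdiagV d : (forall i, d i != 0) ->
  rdiag d \in unitmx /\ invmx (rdiag d) = rdiag (fun i => (d i)^-1).
Proof.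
move=> d0; have H : rdiag d *m rdiag (fun i => (d i)^-1) = 1%:M.
  by rewrite rdiagM -rdiag1; apply: rdiag_eq => i; rewrite divff.
have [U _] := mulmx1_unit H; split=> //.
by rewrite -[LHS]mulmx1 -H mulKmx.
Qed.

Lemma qf_rdiag d y : qf (rdiag d) y = \sum_i d i * sqnorm (y i 0).
Proof.
rewrite /qf mul_mx_diag mxE Re_sum; apply: eq_bigr => i _.
by rewrite !mxE mulrAC conjM_sqnorm ReCM mulrC /=.
Qed.

Lemma qf_rdiag_cst (a : R) x : qf (rdiag (fun=> a)) x = a * qf 1%:M x.
Proof. by rewrite -rdiag1 !qf_rdiag mulr_sumr; apply: eq_bigr => i _; rewrite mul1r. Qed.

Lemma qf_herm M x : M^t* = M -> (x^t* *m M *m x) 0 0 = (qf M x)%:C.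
Proof.
move=> hM; rewrite /qf.
have : (x^t* *m M *m x)^t* = x^t* *m M *m x by rewrite !trmxCM trmxCK hM mulmxA.
move=> /matrixP/(_ 0 0); rewrite !mxE.
case: (\sum_j _) => a b [/= eb]; congr Complex.
by apply/eqP; rewrite -[_ == _](mulrn_eq0 b 2) mulr2n -{1}eb addNr.
Qed.

Lemma RC_gt0 (a : R) : ((0 : R[i]) < a%:C) = (0 < a).
Proof. by rewrite ltcE/= eqxx. Qed.

Lemma posdefP M : posdefmx M <-> M^t* = M /\ forall x, x != 0 -> 0 < qf M x.
Proof.
rewrite /posdefmx/=; split=> -[/hermP hM H]; split=> // x /H h.
- by rewrite -RC_gt0 -qf_herm//; exact: h.
- by move: h; rewrite -RC_gt0 -qf_herm//; exact/hermP.
Qed.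

Lemma possemidefP M : possemidefmx M <-> M^t* = M /\ forall x, 0 <= qf M x.
Proof.
rewrite /possemidefmx/=; split=> -[/hermP hM H]; split=> // x; have h := H x.
- by rewrite -ler0c -qf_herm//; exact: h.
- by move: h; rewrite -ler0c -qf_herm//; exact/hermP.
Qed.

Lemma posdef_herm M : posdefmx M -> M^t* = M.
Proof. by move=> /posdefP[]. Qed.

Lemma posdef_ge0 M x : posdefmx M -> 0 <= qf M x.
Proof.
move=> /posdefP[_ H]; have [->|/H/ltW//] := eqVneq x 0.
by rewrite /qf mulmx0 mxE.
Qed.

Lemma posdef_congr (S M : 'M_m) : S \in unitmx -> posdefmx M ->
  @posdefmx R m (S *m M *m S^t*).
Proof.
move=> uS /posdefP[hM H]; apply/posdefP; split.
  by rewrite !trmxCM trmxCK hM mulmxA.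
move=> x x0; rewrite qf_congr; apply: H.
apply: contra_neq x0 => e.
have u : S^t* \in unitmx by rewrite map_unitmx unitmx_tr.
by rewrite -(mulKmx u x) e mulmx0.
Qed.

Lemma posdef_rdiag d : (forall i, 0 < d i) -> posdefmx (rdiag d).
Proof.
move=> d0; apply/posdefP; split; first exact: rdiag_tr.
move=> x x0; rewrite qf_rdiag lt0r sumr_ge0 ?andbT; last first.
  by move=> i _; rewrite mulr_ge0 ?sqnorm_ge0 ?ltW.
apply: contra_neq x0 => /eqP; rewrite psumr_eq0; last first.
  by move=> i _; rewrite mulr_ge0 ?sqnorm_ge0 ?ltW.
move=> /allP H; apply/colP => i; rewrite mxE.
have := H i; rewrite mem_index_enum => /(_ isT) /=.
rewrite mulf_eq0 gt_eqF//= /sqnorm paddr_eq0 ?sqr_ge0//.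
by rewrite !sqrf_eq0; case: (x i 0) => a b /= /andP[/eqP-> /eqP->].
Qed.

(** A row vector [v] killed by [M] would make the form vanish at the adjoint of [v]. *)
Lemma posdef_unit M : posdefmx M -> M \in unitmx.
Proof.
move=> /posdefP[hM H]; rewrite -row_free_unit -kermx_eq0; apply/rowV0P => v.
move=> /sub_kermxP vM; apply/eqP; apply/negPn/negP => v0.
have /H : v^t* != 0.
  by apply: contra_neq v0 => e; rewrite -[v]trmxCK e trmx0 map_mx0.
by rewrite /qf trmxCK vM mul0mx mxE ltxx.
Qed.

(** Polarization: the quadratic form of a Hermitian matrix determines the matrix,
    which reduces equalities and limits of matrices to scalar ones. *)
Lemma qf_polar M x y : M^t* = M ->
  complex.Re ((x^t* *m M *m y) 0 0) = (qf M (x + y) - qf M x - qf M y) / 2.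
Proof.
move=> hM; pose b (u v : 'cV[R[i]]_m) := complex.Re ((u^t* *m M *m v) 0 0).
have bDl u v z : b (u + v) z = b u z + b v z.
  by rewrite /b trmxCD !mulmxDl mxE ReD.
have bDr u v z : b u (v + z) = b u v + b u z by rewrite /b mulmxDr mxE ReD.
have bC : b y x = b x y.
  have -> : b y x = complex.Re ((x^t* *m M *m y)^t* 0 0).
    by rewrite /b !trmxCM trmxCK hM mulmxA.
  by rewrite [in LHS]mxE [in LHS]mxE /b; case: (_ 0 0).
suff : b x y = (b (x + y) (x + y) - b x x - b y y) / 2 by [].
rewrite bDl !bDr bC; move: (b x x) (b y y) (b x y) => p q r; by field.
Qed.

Lemma mx_entry M i j : ((delta_mx i 0)^t* *m M *m delta_mx j 0 : 'M[R[i]]_1) 0 0 = M i j.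
Proof.
rewrite trmx_delta map_delta_mx -mulmxA -colE -rowE !mxE//.
Qed.

(** The [(i, j)] entry of the Hermitian matrix with the form [f]; the second line is its
    imaginary part, since the real part of ['i z] is the opposite of the imaginary part
    of [z]. *)
Definition polarize (f : 'cV[R[i]]_m -> R) i j : R[i] :=
  let e k : 'cV_m := delta_mx k 0 in
  Complex ((f (e i + e j) - f (e i) - f (e j)) / 2)
          (- ((f (e i + 'i%C *: e j) - f (e i) - f ('i%C *: e j)) / 2)).

Lemma herm_polarize M i j : M^t* = M -> M i j = polarize (qf M) i j.
Proof.
move=> hM; rewrite /polarize -!(qf_polar _ _ hM) mx_entry -scalemxAr mxE mx_entry.
by case: (M i j) => a b /=; congr Complex; ring.
Qed.

Lemma herm_qf_inj A B : A^t* = A -> B^t* = B -> qf A =1 qf B -> A = B.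
Proof.
move=> hA hB e; apply/matrixP => i j.
by rewrite (herm_polarize i j hA) (herm_polarize i j hB) (funext e).
Qed.

End QuadraticForms.

(** * Simultaneous diagonalization by congruence *)

Section JointDiagonalization.
Context {R : realType} {m : nat}.
Implicit Types (A B M X C S U : 'M[R[i]]_m) (x y : 'cV[R[i]]_m) (d : 'I_m -> R).

(** [spectralmx M] has the eigenvectors as conjugated rows; the adjoint puts them in
    columns, so that [M = U D U*] with [U = eigvecs M]. *)
Definition eigvecs M : 'M[R[i]]_m := (spectralmx M)^t*.
Definition eigvals M (i : 'I_m) : R := complex.Re (spectral_diag M 0 i).

Lemma eigvecs_unitary M :
  (eigvecs M)^t* *m eigvecs M = 1%:M /\ eigvecs M *m (eigvecs M)^t* = 1%:M.
Proof.
have /unitarymxP := spectral_unitarymx M; rewrite /eigvecs trmxCK => H.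
by split=> //; exact: mulmx1C.
Qed.

Lemma spectral_decomp M : M^t* = M ->
  M = eigvecs M *m rdiag (eigvals M) *m (eigvecs M)^t*.
Proof.
move=> /hermP hM; rewrite /eigvecs trmxCK.
have /orthomx_spectralP {1}-> := hermitian_normalmx hM.
rewrite invmx_unitary; last exact: spectral_unitarymx.
congr (_ *m _ *m _).
congr diag_mx; apply/rowP => i; rewrite mxE RRe_real//.
by have /mxOverP := hermitian_spectral_diag_real hM; apply.
Qed.

Lemma eigvals_gt0 M : posdefmx M -> forall i, 0 < eigvals M i.
Proof.
move=> /posdefP[hM H] i; have [U1 U2] := eigvecs_unitary M.
have /H : eigvecs M *m delta_mx i 0 != 0 :> 'cV_m.
  apply/negP => /eqP e; have := congr1 (mulmx ((eigvecs M)^t*)) e.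
  rewrite mulmxA U1 mul1mx mulmx0 => /matrixP/(_ i 0); rewrite !mxE !eqxx.
  by move/eqP; rewrite oner_eq0.
rewrite {1}(spectral_decomp hM) qf_congr mulmxA U1 mul1mx qf_rdiag.
rewrite (bigD1 i)//= big1 => [|j ji]; rewrite mxE ?eqxx ?(negbTE ji) /sqnorm /=.
  by rewrite expr1n expr0n/= !addr0 mulr1.
by rewrite expr0n/= addr0 mulr0.
Qed.

(** The [d i] are the eigenvalues of [X^-1 C], and any function of two positive
    definite matrices that is natural under congruence acts on the [d i] alone. *)
Definition jdiag X C S d :=
  [/\ S \in unitmx, forall i, 0 < d i, X = S *m S^t* & C = S *m rdiag d *m S^t*].

(** Factor [X = T T*] with [T = U sqrt(D)], then diagonalize [T^-1 C T^-*] unitarily. *)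
Lemma jdiag_exists X C : posdefmx X -> posdefmx C -> exists S d, jdiag X C S d.
Proof.
move=> pX pC; have hX := posdef_herm pX.
pose r i := Num.sqrt (eigvals X i).
have r0 i : 0 < r i by rewrite sqrtr_gt0 eigvals_gt0.
pose T := eigvecs X *m rdiag r; have [U1 U2] := eigvecs_unitary X.
have XT : X = T *m T^t*.
  rewrite /T trmxCM rdiag_tr mulmxA -(mulmxA _ (rdiag r) (rdiag r)) rdiagM {1}(spectral_decomp hX).
  congr (_ *m _ *m _); apply: rdiag_eq => i.
  by rewrite -expr2 sqr_sqrtr// ltW// eigvals_gt0.
have uT : T \in unitmx.
  rewrite unitmx_mul; apply/andP; split; first by have [] := mulmx1_unit U2.
  by have [] := rdiagV (fun i => lt0r_neq0 (r0 i)).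
pose D := invmx T *m C *m (invmx T)^t*.
have pD : posdefmx D by apply: posdef_congr; rewrite ?unitmx_inv.
have [V1 V2] := eigvecs_unitary D.
exists (T *m eigvecs D), (eigvals D); split.
- by rewrite unitmx_mul uT /=; have [] := mulmx1_unit V2.
- exact: eigvals_gt0.
- by rewrite trmxCM mulmxA -(mulmxA T) V2 mulmx1.
- have -> : T *m eigvecs D *m rdiag (eigvals D) *m (T *m eigvecs D)^t* = T *m D *m T^t*.
    by rewrite [in RHS](spectral_decomp (posdef_herm pD)) trmxCM !mulmxA.
  rewrite /D !mulmxA mulmxV// mul1mx -mulmxA -trmxCM mulmxV//.
  by rewrite trmx1 map_mx1 mulmx1.
Qed.

Section FixedDiagonalization.
Variables (X C S : 'M[R[i]]_m) (d : 'I_m -> R).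
Hypothesis jd : jdiag X C S d.

Lemma jdiag_qfX x : qf X x = \sum_i sqnorm ((S^t* *m x) i 0).
Proof.
have [_ _ -> _] := jd; rewrite -[S in S *m _]mulmx1 -rdiag1 qf_congr qf_rdiag.
by apply: eq_bigr => i _; rewrite mul1r.
Qed.

Lemma jdiag_qfC x : qf C x = \sum_i d i * sqnorm ((S^t* *m x) i 0).
Proof. by have [_ _ _ ->] := jd; rewrite qf_congr qf_rdiag. Qed.

Lemma jdiag_solve y : exists x, S^t* *m x = y.
Proof.
have [uS _ _ _] := jd; have u : S^t* \in unitmx by rewrite map_unitmx unitmx_tr.
by exists (invmx (S^t*) *m y); rewrite mulKVmx.
Qed.

End FixedDiagonalization.

(** * Weighted harmonic means *)

(** The matrix [(s X^-1 + (1 - s) C^-1)^-1], in a form that avoids the inverses of [X]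
    and [C]: for [s = 0] it is [C] and for [s = 1] it is [X]. *)
Definition hmean (s : R) X C : 'M[R[i]]_m :=
  C *m invmx (s%:C *: C + (1 - s)%:C *: X) *m X.

Lemma hmeanxx s X : X \in unitmx -> hmean s X X = X.
Proof.
move=> uX; rewrite /hmean -scalerDl -rmorphD addrC subrK scale1r.
by rewrite mulmxV// mul1mx.
Qed.

(** The scalar case of [hmean]: the weighted harmonic mean of [1] and [t]. *)
Definition hfun (s t : R) := t / (s * t + (1 - s)).

Lemma hden_gt0 (s t : R) : 0 <= s <= 1 -> 0 < t -> 0 < s * t + (1 - s).
Proof. by move=> /andP[s0 s1] t0; nra. Qed.

Lemma hmean_jdiag s X C S d : 0 <= s <= 1 -> jdiag X C S d ->
  hmean s X C = S *m rdiag (fun i => hfun s (d i)) *m S^t*.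
Proof.
move=> s01 [uS d0 -> ->]; rewrite /hmean.
have e0 i : s * d i + (1 - s) != 0 by rewrite gt_eqF ?hden_gt0.
have [uE iE] := rdiagV e0.
have u : S^t* \in unitmx by rewrite map_unitmx unitmx_tr.
have -> : s%:C *: (S *m rdiag d *m S^t*) + (1 - s)%:C *: (S *m S^t*) =
    S *m rdiag (fun i => s * d i + (1 - s)) *m S^t*.
  have Zin a (D : 'M[R[i]]_m) : a *: (S *m D *m S^t*) = S *m (a *: D) *m S^t*.
    by rewrite scalemxAl scalemxAr.
  have -> : rdiag (fun i => s * d i + (1 - s)) =
      s%:C *: rdiag d + (1 - s)%:C *: rdiag (fun=> 1) :> 'M[R[i]]_m.
    by rewrite !rdiagZ rdiagD; apply: rdiag_eq => i; rewrite mulr1.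
  rewrite mulmxDr mulmxDl; congr (_ + _); first exact: Zin.
  by rewrite -(Zin _ (rdiag _)) rdiag1 mulmx1.
rewrite !invmx_mul ?unitmx_mul ?uS ?uE//.
rewrite iE -!mulmxA mulKVmx// !mulmxA mulmxKV//.
by rewrite -!mulmxA; congr (_ *m _); rewrite !mulmxA rdiagM.
Qed.

Lemma hmean_qf s X C S d x : 0 <= s <= 1 -> jdiag X C S d ->
  qf (hmean s X C) x = \sum_i hfun s (d i) * sqnorm ((S^t* *m x) i 0).
Proof. by move=> s01 jd; rewrite (hmean_jdiag s01 jd) qf_congr qf_rdiag. Qed.

Lemma hfun_gt0 s t : 0 <= s <= 1 -> 0 < t -> 0 < hfun s t.
Proof. by move=> s01 t0; rewrite divr_gt0// hden_gt0. Qed.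

Lemma hmean_posdef s X C : 0 <= s <= 1 -> posdefmx X -> posdefmx C ->
  posdefmx (hmean s X C).
Proof.
move=> s01 pX pC; have [S [d jd]] := jdiag_exists pX pC.
have [uS d0 _ _] := jd; rewrite (hmean_jdiag s01 jd).
by apply: (posdef_congr uS); apply: posdef_rdiag => i; exact: hfun_gt0.
Qed.

(** The two sides differ by [s (1 - s) |u - t v| ^ 2 / (s t + (1 - s))]. *)
Lemma hfun_le (s t : R) (u v : R[i]) : 0 <= s <= 1 -> 0 < t ->
  hfun s t * sqnorm (s%:C * u + (1 - s)%:C * v) <=
  s * sqnorm u + (1 - s) * (t * sqnorm v).
Proof.
move=> s01 t0; have D0 := hden_gt0 s01 t0.
rewrite /hfun mulrAC ler_pdivrMr// /sqnorm; case: u v => [a b] [a' b'] /=.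
rewrite -subr_ge0.
set E := (X in 0 <= X).
have -> : E = s * (1 - s) * ((a - t * a') ^+ 2 + (b - t * b') ^+ 2) by rewrite /E; ring.
by case/andP: s01 => s0 s1; apply: mulr_ge0; [rewrite mulr_ge0 ?subr_ge0|rewrite addr_ge0 ?sqr_ge0].
Qed.

(** First half of the variational formula of the harmonic mean: its form at [x] is at
    most the cost of any splitting [x = s y + (1 - s) z]. *)
Lemma hmean_le s X C x y z : 0 <= s <= 1 -> posdefmx X -> posdefmx C ->
  x = s%:C *: y + (1 - s)%:C *: z ->
  qf (hmean s X C) x <= s * qf X y + (1 - s) * qf C z.
Proof.
move=> s01 pX pC ->; have [S [d jd]] := jdiag_exists pX pC.
have [uS d0 _ _] := jd.
rewrite (hmean_qf _ s01 jd) (jdiag_qfX jd) (jdiag_qfC jd) !mulr_sumr -big_split/=.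
apply: ler_sum => i _; rewrite mulmxDr -!scalemxAr.
rewrite mxE [X in X + _]mxE [X in _ + X]mxE.
exact: hfun_le.
Qed.

(** Second half: the minimum is attained.  In the coordinates [S* x] of a simultaneous
    diagonalization, equality holds in [hfun_le] when [y_i = d_i z_i]. *)
Lemma hmean_attained s X C x : 0 <= s <= 1 -> posdefmx X -> posdefmx C ->
  exists y z, x = s%:C *: y + (1 - s)%:C *: z /\
    qf (hmean s X C) x = s * qf X y + (1 - s) * qf C z.
Proof.
move=> s01 pX pC; have [S [d jd]] := jdiag_exists pX pC.
have [uS d0 _ _] := jd.
have D0 i := hden_gt0 s01 (d0 i).
pose e i := (s * d i + (1 - s))^-1.
have [z zE] := jdiag_solve jd (rdiag e *m (S^t* *m x)).
have [y yE] := jdiag_solve jd (rdiag (fun i => d i * e i) *m (S^t* *m x)).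
exists y, z; split.
  have u : S^t* \in unitmx by rewrite map_unitmx unitmx_tr.
  rewrite -[LHS](mulKmx u) -[RHS](mulKmx u); congr (_ *m _).
  rewrite mulmxDr -!scalemxAr yE zE !scalemxAl -mulmxDl !rdiagZ rdiagD.
  rewrite -[LHS]mul1mx -rdiag1; congr (_ *m _); apply: rdiag_eq => i.
  by rewrite /e; field; rewrite gt_eqF.
rewrite (hmean_qf _ s01 jd) (jdiag_qfX jd) (jdiag_qfC jd) !mulr_sumr -big_split/=.
apply: eq_bigr => i _; rewrite yE zE !mul_diag_mx !mxE /hfun.
case: (\sum_j _) => a b; rewrite /sqnorm /= !mul0r !subr0 !addr0 /e.
by field; rewrite gt_eqF.
Qed.

Lemma hmean_mono s X X' C C' x : 0 <= s <= 1 -> posdefmx X -> posdefmx C ->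
  posdefmx X' -> posdefmx C' -> (forall y, qf X y <= qf X' y) ->
  (forall y, qf C y <= qf C' y) -> qf (hmean s X C) x <= qf (hmean s X' C') x.
Proof.
move=> s01 pX pC pX' pC' XX CC.
have [y [z [e ->]]] := hmean_attained x s01 pX' pC'.
apply: le_trans (hmean_le s01 pX pC e) _.
by case/andP: s01 => s0 s1; rewrite lerD// ler_wpM2l// subr_ge0.
Qed.

Lemma posdef_conv t A B : 0 <= t <= 1 -> posdefmx A -> posdefmx B ->
  posdefmx (t%:C *: A + (1 - t)%:C *: B).
Proof.
move=> /andP[t0 t1] /posdefP[hA pA] /posdefP[hB pB]; apply/posdefP; split.
  by rewrite trmxCD (trmxCZ t A) (trmxCZ (1 - t) B) hA hB.
move=> x x0; rewrite qfD !qfZ.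
have a0 := pA x x0; have b0 := pB x x0.
have [->|tn] := eqVneq t 0; first by rewrite mul0r add0r subr0 mul1r.
have t0' : 0 < t by rewrite lt0r tn.
apply: ltr_pwDl; first exact: mulr_gt0.
by apply: mulr_ge0; [rewrite subr_ge0|exact: ltW].
Qed.

Lemma mix_le (s t h1 h2 a b c d : R) : 0 <= t <= 1 ->
  h1 <= s * a + (1 - s) * c -> h2 <= s * b + (1 - s) * d ->
  t * h1 + (1 - t) * h2 <= s * (t * a + (1 - t) * b) + (1 - s) * (t * c + (1 - t) * d).
Proof. by move=> /andP[t0 t1] H1 H2; nra. Qed.

(** For a fixed splitting of [x] the cost is linear in the pair of matrices, and a
    minimum of linear functions is concave. *)
Lemma hmean_concave s t X Y C D x : 0 <= s <= 1 -> 0 <= t <= 1 ->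
  posdefmx X -> posdefmx Y -> posdefmx C -> posdefmx D ->
  t * qf (hmean s X C) x + (1 - t) * qf (hmean s Y D) x <=
  qf (hmean s (t%:C *: X + (1 - t)%:C *: Y) (t%:C *: C + (1 - t)%:C *: D)) x.
Proof.
move=> s01 t01 pX pY pC pD.
have [y [z [e ->]]] := hmean_attained x s01 (posdef_conv t01 pX pY) (posdef_conv t01 pC pD).
have h1 := hmean_le s01 pX pC e; have h2 := hmean_le s01 pY pD e.
by rewrite !qfD !qfZ; exact: mix_le.
Qed.

End JointDiagonalization.

(** * Riemann sums for the logarithm *)

Section Rlog.
Context {R : realType}.
Implicit Types (t u : R) (N k : nat).

(** The integrand of [ln t = int_0^1 (t - 1) / (1 + s (t - 1)) ds] equals
    [(hfun s t - 1) / (1 - s)].  At the node [s = k / N] the factor [1 / (1 - s)] times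
    the step [1 / N] is the weight [1 / (N - k)]. *)
Definition hweight N k : R := (N - k)%:R^-1.
Definition hnode N k : R := k%:R / N%:R.

Lemma hnode01 N k : (k < N)%N -> 0 <= hnode N k <= 1.
Proof.
move=> kN; have N0 : (0 : R) < N%:R by rewrite ltr0n (leq_ltn_trans _ kN).
by rewrite divr_ge0//= ler_pdivrMr// mul1r ler_nat ltnW.
Qed.

Lemma hweight_ge0 N k : 0 <= hweight N k.
Proof. by rewrite invr_ge0. Qed.

(** The left Riemann sum: the integrand is nonincreasing in [s], so the sum
    overestimates [ln], and decreases when the mesh is halved. *)
Definition riemann_log N t : R := \sum_(k < N) hweight N k * (hfun (hnode N k) t - 1).

(** The values at the nodes of the denominator [1 + s (t - 1)], which interpolates
    between [1] and [t]; [ln t] telescopes along them. *)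
Definition node N t k : R := 1 + hnode N k * (t - 1).

Lemma node_gt0 N t k : 0 < t -> (k <= N)%N -> (0 < N)%N -> 0 < node N t k.
Proof.
move=> t0 kN N0; have N0' : (0 : R) < N%:R by rewrite ltr0n.
have h1 : hnode N k <= 1 by rewrite ler_pdivrMr// mul1r ler_nat.
have h0 : 0 <= hnode N k by rewrite divr_ge0.
by rewrite /node; nra.
Qed.

Lemma riemann_logE N t : 0 < t -> riemann_log N t = \sum_(k < N) (t - 1) / N%:R / node N t k.
Proof.
move=> t0; apply: eq_bigr => k _.
have N0 : (0 < N)%N by apply: leq_ltn_trans (ltn_ord k).
have N0' : (0 : R) < N%:R by rewrite ltr0n.
have k0 := node_gt0 t0 (ltnW (ltn_ord k)) N0.
have Nk : (0 : R) < N%:R - k%:R by rewrite subr_gt0 ltr_nat.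
rewrite /hweight /hfun natrB 1?ltnW//.
have -> : hnode N k * t + (1 - hnode N k) = node N t k by rewrite /node; ring.
move: k0; rewrite /node /hnode => k0.
have e : 1 + k%:R / N%:R * (t - 1) = (N%:R + k%:R * (t - 1)) / N%:R :> R.
  by field; rewrite gt_eqF.
rewrite e in k0 *.
have e0 : 0 < N%:R + k%:R * (t - 1) :> R by rewrite pmulr_lgt0 ?invr_gt0 in k0.
by field; rewrite !gt_eqF.
Qed.

Lemma ln_le_sub1 (x : R) : 0 < x -> ln x <= x - 1.
Proof. by move=> x0; have := expR_ge1Dx (ln x); rewrite lnK// => h; lra. Qed.

Lemma node_step N t k : (0 < N)%N -> node N t k.+1 = node N t k + (t - 1) / N%:R.
Proof.
move=> N0; rewrite /node /hnode -[k.+1]addn1 natrD.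
by field; rewrite gt_eqF// ltr0n.
Qed.

Lemma node0 N t : node N t 0 = 1.
Proof. by rewrite /node /hnode mul0r mul0r addr0. Qed.

Lemma nodeN N t : (0 < N)%N -> node N t N = t.
Proof. by move=> N0; rewrite /node /hnode divff ?pnatr_eq0 -?lt0n//; ring. Qed.

Lemma sum_ln_node N t : 0 < t -> (0 < N)%N ->
  ln t = \sum_(k < N) (ln (node N t k.+1) - ln (node N t k)).
Proof.
move=> t0 N0; rewrite -(big_mkord xpredT (fun k => ln (node N t k.+1) - ln (node N t k))).
by rewrite telescope_sumr// node0 nodeN// ln1 subr0.
Qed.

Lemma ln_le_riemann_log N t : 0 < t -> (0 < N)%N -> ln t <= riemann_log N t.
Proof.
move=> t0 N0; rewrite (sum_ln_node t0 N0) riemann_logE//; apply: ler_sum => k _.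
have a0 := node_gt0 t0 (ltnW (ltn_ord k)) N0.
have b0 := node_gt0 t0 (ltn_ord k) N0.
rewrite -ln_div ?posrE//; apply: le_trans (ln_le_sub1 _) _; first exact: divr_gt0.
rewrite node_step// le_eqVlt; apply/orP; left; apply/eqP; field.
by rewrite !gt_eqF// ltr0n.
Qed.

(** The gap between the left and the right Riemann sums telescopes to
    [((t - 1) - (t - 1) / t) / N]. *)
Lemma riemann_log_le_ln N t : 0 < t -> (0 < N)%N ->
  riemann_log N t <= ln t + (t - 2 + t^-1) / N%:R.
Proof.
move=> t0 N0; have N0' : (0 : R) < N%:R by rewrite ltr0n.
pose c := (t - 1) / N%:R.
have -> : (t - 2 + t^-1) / N%:R = \sum_(k < N) (c / node N t k - c / node N t k.+1).
  rewrite -(big_mkord xpredT (fun k => c / node N t k - c / node N t k.+1)).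
  rewrite (@telescope_sumr_eq _ _ _ (fun k => - (c / node N t k)))//; last first.
    by move=> k _; rewrite opprK addrC.
  by rewrite node0 nodeN// /c; field; rewrite !gt_eqF.
rewrite (sum_ln_node t0 N0) riemann_logE// -big_split/=; apply: ler_sum => k _.
have a0 := node_gt0 t0 (ltnW (ltn_ord k)) N0.
have b0 := node_gt0 t0 (ltn_ord k) N0.
suff : c / node N t k.+1 <= ln (node N t k.+1) - ln (node N t k).
  by rewrite -/c => h; lra.
rewrite -lerN2 opprB -ln_div ?posrE//; apply: le_trans (ln_le_sub1 _) _; first exact: divr_gt0.
rewrite le_eqVlt; apply/orP; left; apply/eqP.
have -> : node N t k = node N t k.+1 - c by rewrite node_step// addrK.
by field; rewrite gt_eqF.
Qed.

Lemma sum_double (F : nat -> R) N :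
  \sum_(k < N.*2) F k = \sum_(k < N) (F k.*2 + F k.*2.+1).
Proof.
rewrite -(big_mkord xpredT F) -(big_mkord xpredT (fun k => F k.*2 + F k.*2.+1)).
elim: N => [|N IH]; first by rewrite !big_geq.
by rewrite doubleS !big_nat_recr//= IH addrA.
Qed.

Lemma riemann_log_double N t : 0 < t -> (0 < N)%N -> riemann_log N.*2 t <= riemann_log N t.
Proof.
move=> t0 N0; rewrite !riemann_logE//.
rewrite (sum_double (fun k => (t - 1) / N.*2%:R / node N.*2 t k)); apply: ler_sum => k _.
have N0' : (0 : R) < N%:R by rewrite ltr0n.
have D0 : (0 < N.*2)%N by rewrite double_gt0.
have a0 := node_gt0 t0 (ltnW (ltn_ord k)) N0.
have ke : node N.*2 t k.*2 = node N t k.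
  by rewrite /node /hnode -!muln2 !natrM; field; rewrite gt_eqF.
have b0 : 0 < node N.*2 t k.*2.+1 by apply: node_gt0; rewrite ?ltn_double.
rewrite ke; move: b0; rewrite node_step// ke.
have -> : (N.*2)%:R = 2 * N%:R :> R by rewrite -muln2 natrM mulrC.
move: (node N t k) a0 => b a0; set c := (t - 1) / (2 * N%:R) => b0.
have -> : (t - 1) / N%:R / b = c / b + c / b by rewrite /c; field; rewrite !gt_eqF.
rewrite lerD2l ler_pdivrMr// -subr_ge0.
have -> : c / b * (b + c) - c = c ^+ 2 / b by field; rewrite gt_eqF.
by rewrite divr_ge0 ?sqr_ge0 ?ltW.
Qed.

End Rlog.

(** * Limits of monotone sequences of matrices *)

Section RealLimits.
Context {R : realType}.
Implicit Types (u v : nat -> R) (l c : R).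

Lemma cvg_le_const u l c : u k @[k --> \oo] --> l -> (forall k, u k <= c) -> l <= c.
Proof.
move=> ul uc; apply: (ler_cvg_to ul (cvg_cst c)); exact: nearW.
Qed.

Lemma cvg_ge_const u l c : u k @[k --> \oo] --> l -> (forall k, c <= u k) -> c <= l.
Proof.
move=> ul uc; apply: (ler_cvg_to (cvg_cst c) ul); exact: nearW.
Qed.

Lemma cvg_sumr (I : Type) (r : seq I) (f : I -> nat -> R) (l : I -> R) :
  (forall i, f i k @[k --> \oo] --> l i) ->
  (\sum_(i <- r) f i k) @[k --> \oo] --> \sum_(i <- r) l i.
Proof. by move=> h; apply: cvg_big => // x; exact: add_continuous. Qed.

Lemma cvg_decr u c : (forall k, u k.+1 <= u k) -> (forall k, c <= u k) ->
  exists l, u k @[k --> \oo] --> l /\ forall k, l <= u k.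
Proof.
move=> ud uc; have hd : {homo u : n k / (n <= k)%N >-> k <= n}.
  by apply/nonincreasing_seqP.
have cu : cvgn u.
  by apply: nonincreasing_is_cvgn => //; exists c => _ [k _ <-].
exists (limn u); split=> // k; exact: nonincreasing_cvgn_ge.
Qed.

Lemma cvg_shiftl u l k : u j @[j --> \oo] --> l -> u (k + j)%N @[j --> \oo] --> l.
Proof.
rewrite -(cvg_shiftn k) => h.
have -> // : (fun j => u (k + j)%N) = (fun j => u (j + k)%N).
by apply/funext => j; rewrite addnC.
Qed.

Lemma le0_of_le_div_exp2 (a K : R) : (forall k, a <= K / (2 ^ k)%:R) -> a <= 0.
Proof.
move=> h; rewrite leNgt; apply/negP => a0.
have [k hk] : exists k : nat, K / a < k%:R.
  by exists (Num.bound `|K / a|); apply: le_lt_trans (ler_norm _) (archi_boundP _).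
have := h k; rewrite ler_pdivlMr ?ltr0n ?expn_gt0// => h'.
move: hk; rewrite ltr_pdivrMr// => hk.
have : k%:R <= (2 ^ k)%:R :> R by rewrite ler_nat ltnW// ltn_expl.
nra.
Qed.

End RealLimits.

Section MatrixLimits.
Context {R : realType} {m : nat}.
Implicit Types (M X Z : 'M[R[i]]_m) (x : 'cV[R[i]]_m).

Lemma qf_expand M x : qf M x = \sum_i \sum_j
  (complex.Re ((x i 0)^* * x j 0)%R * complex.Re (M i j)
   - complex.Im ((x i 0)^* * x j 0)%R * complex.Im (M i j)).
Proof.
rewrite /qf mxE Re_sum exchange_big/=; apply: eq_bigr => j _.
rewrite mxE mulr_suml Re_sum; apply: eq_bigr => i _.
rewrite !mxE mulrAC; move: (_ * x j 0)%R => c; by case: c => a b; case: (M i j).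
Qed.

(** The forms converge pointwise by scalar monotone convergence, hence so do the
    entries, by polarization; the form of the limit matrix is the limit of the forms
    because it is linear in the entries. *)
Lemma decreasing_herm_limit (Xs : nat -> 'M[R[i]]_m) Z :
  (forall k, (Xs k)^t* = Xs k) ->
  (forall k x, qf (Xs k.+1) x <= qf (Xs k) x) ->
  (forall k x, qf Z x <= qf (Xs k) x) ->
  exists X, [/\ X^t* = X, forall x, qf (Xs k) x @[k --> \oo] --> qf X x &
    forall k x, qf X x <= qf (Xs k) x].
Proof.
move=> hX dX lX.
have /choice [f fP] : forall x, exists l, qf (Xs k) x @[k --> \oo] --> l /\ forall k, l <= qf (Xs k) x.
  move=> x; apply: (@cvg_decr _ (fun k => qf (Xs k) x) (qf Z x)) => k; [exact: dX|exact: lX].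
have cf x : qf (Xs k) x @[k --> \oo] --> f x by have [] := fP x.
pose X : 'M[R[i]]_m := \matrix_(i, j) polarize f i j.
have cRe i j : complex.Re (Xs k i j) @[k --> \oo] --> complex.Re (X i j).
  rewrite mxE /=; under eq_fun do rewrite herm_polarize//=.
  by apply: cvgMl; apply: cvgB => //; apply: cvgB.
have cIm i j : complex.Im (Xs k i j) @[k --> \oo] --> complex.Im (X i j).
  rewrite mxE /=; under eq_fun do rewrite herm_polarize//=.
  by apply: cvgN; apply: cvgMl; apply: cvgB => //; apply: cvgB.
have E x : qf X x = f x.
  apply: cvg_unique _ (cf x) => //.
  rewrite qf_expand (funext (fun k => qf_expand (Xs k) x)).
  by apply: cvg_sumr => i; apply: cvg_sumr => j; apply: cvgB; apply: cvgMr.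
exists X; split.
- apply/matrixP => i j; rewrite mxE mxE.
  have eRe : complex.Re (X j i) = complex.Re (X i j).
    apply: cvg_unique (cRe j i) _ => //.
    have -> : (fun k => complex.Re (Xs k j i)) = (fun k => complex.Re (Xs k i j)).
      by apply/funext => k; rewrite -[in LHS]hX !mxE; case: (Xs k i j).
    exact: cRe.
  have eIm : complex.Im (X j i) = - complex.Im (X i j).
    apply: cvg_unique (cIm j i) _ => //.
    have -> : (fun k => complex.Im (Xs k j i)) = (fun k => - complex.Im (Xs k i j)).
      by apply/funext => k; rewrite -[in LHS]hX !mxE; case: (Xs k i j).
    by apply: cvgN.
  by move: eRe eIm; case: (X j i) => a b; case: (X i j) => a' b' /= -> ->; rewrite -[LHS]/(conjc _) /= opprK.
- by move=> x; rewrite E.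
- by move=> k x; rewrite E; have [_] := fP x.
Qed.

End MatrixLimits.

(** * Approximate relative entropy and its monotone iteration *)

Section Approximation.
Context {R : realType} {m n : nat}.
Implicit Types (M X Y Z : 'M[R[i]]_m) (x y : 'cV[R[i]]_m) (C D : 'I_n -> 'M[R[i]]_m).
Variable w : 'I_n -> R.
Hypothesis ww : weight w.

Lemma weight_ge0 i : 0 <= w i.
Proof. by have [h _] := ww; exact: ltW. Qed.

(** From below, [hmean s X C] bounds the terms by monotonicity; from above, the
    splitting of [x] that is optimal for [X] does, and its cost converges. *)
Lemma hmean_cvg (s : R) (Xs : nat -> 'M[R[i]]_m) X (C : 'M[R[i]]_m) x : 0 <= s <= 1 ->
  posdefmx C -> posdefmx X -> (forall k, posdefmx (Xs k)) ->
  (forall k y, qf X y <= qf (Xs k) y) ->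
  (forall y, qf (Xs k) y @[k --> \oo] --> qf X y) ->
  qf (hmean s (Xs k) C) x @[k --> \oo] --> qf (hmean s X C) x.
Proof.
move=> s01 pC pX pXs le_XXs cXs.
have [y [z [e hE]]] := hmean_attained x s01 pX pC.
apply: (@squeeze_cvgr _ _ _ _ (fun=> qf (hmean s X C) x)
  (fun k => s * qf (Xs k) y + (1 - s) * qf C z)); last first.
- by rewrite hE; apply: cvgD; [apply: cvgMr|apply: cvg_cst].
- exact: cvg_cst.
apply: nearW => k; apply/andP; split; last exact: (hmean_le s01 (pXs k) pC e).
exact: (hmean_mono x s01 pX pC (pXs k) pC (le_XXs k) (fun y => lexx _)).
Qed.

(** With [jdiag X (C i) S d] the [i]-th summand is the form of [S (riemann_log N d) S*],
    an approximation from above of the relative operator entropy [S (ln d) S*]. *)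
Definition qentropy N C X x : R :=
  \sum_i w i * \sum_(k < N) hweight N k * (qf (hmean (hnode N k) X (C i)) x - qf X x).

Definition hweight_total N : R := \sum_(k < N) hweight N k.

Lemma hweight_total_gt0 N : (0 < N)%N -> 0 < hweight_total N.
Proof.
case: N => // N _; rewrite /hweight_total big_ord_recr/= ltr_wpDl ?sumr_ge0//.
  by move=> k _; exact: hweight_ge0.
by rewrite invr_gt0 ltr0n subSnn.
Qed.

(** The convex combination of harmonic means for which
    [hstep N C X - X] is [qentropy N C X] up to the factor [hweight_total N].  The
    normalization turns the sign of the entropy into a comparison of [X] with a map
    that is monotone in [X]. *)
Definition hstep N C X : 'M[R[i]]_m :=
  \sum_i \sum_(k < N) (w i * hweight N k / hweight_total N)%:C *: hmean (hnode N k) X (C i).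

Lemma qf_hstep N C X x : (0 < N)%N ->
  qf (hstep N C X) x = qf X x + qentropy N C X x / hweight_total N.
Proof.
move=> N0; have c0 := hweight_total_gt0 N0; have [_ w1] := ww.
have -> : qentropy N C X x = \sum_i w i * \sum_(k < N) hweight N k * qf (hmean (hnode N k) X (C i)) x
   - hweight_total N * qf X x.
  rewrite /qentropy; under eq_bigr do under eq_bigr do rewrite mulrBr.
  under eq_bigr do rewrite sumrB -mulr_suml mulrBr.
  by rewrite sumrB -mulr_suml w1 mul1r.
rewrite mulrBl mulrAC divff ?gt_eqF// mul1r addrC subrK.
rewrite qf_sum mulr_suml; apply: eq_bigr => i _.
rewrite qf_sum -mulrA mulr_suml mulr_sumr; apply: eq_bigr => k _.
by rewrite qfZ; field; rewrite gt_eqF.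
Qed.

Lemma hstep_herm N C X : (forall i, posdefmx (C i)) -> posdefmx X ->
  (hstep N C X)^t* = hstep N C X.
Proof.
move=> pC pX; rewrite /hstep trmxC_sum; apply: eq_bigr => i _.
rewrite trmxC_sum; apply: eq_bigr => k _; rewrite trmxCZ.
by rewrite (posdef_herm (hmean_posdef (hnode01 (ltn_ord k)) pX (pC i))).
Qed.

Lemma qentropy_ge0_hstep N C X : (0 < N)%N ->
  (forall x, 0 <= qentropy N C X x) <-> (forall x, qf X x <= qf (hstep N C X) x).
Proof.
move=> N0; have c0 := hweight_total_gt0 N0; split=> h x; have := h x; rewrite qf_hstep// lerDl.
  by move=> ?; rewrite divr_ge0// ltW.
by rewrite pmulr_lge0 ?invr_gt0.
Qed.

Lemma hstep_mono N C X Y x : (forall i, posdefmx (C i)) -> posdefmx X -> posdefmx Y ->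
  (forall y, qf X y <= qf Y y) -> qf (hstep N C X) x <= qf (hstep N C Y) x.
Proof.
move=> pC pX pY XY; rewrite !qf_sum; apply: ler_sum => i _.
rewrite !qf_sum; apply: ler_sum => k _; rewrite !qfZ ler_wpM2l//.
  rewrite !mulr_ge0 ?hweight_ge0 ?weight_ge0// invr_ge0 sumr_ge0// => j _; exact: hweight_ge0.
exact: (hmean_mono x (hnode01 (ltn_ord k)) pX (pC i) pY (pC i) XY (fun y => lexx _)).
Qed.

Lemma qentropy_cvg N C (Xs : nat -> 'M[R[i]]_m) X x :
  (forall i, posdefmx (C i)) -> posdefmx X -> (forall k, posdefmx (Xs k)) ->
  (forall k y, qf X y <= qf (Xs k) y) ->
  (forall y, qf (Xs k) y @[k --> \oo] --> qf X y) ->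
  qentropy N C (Xs k) x @[k --> \oo] --> qentropy N C X x.
Proof.
move=> pC pX pXs le_XXs cXs; apply: cvg_sumr => i; apply: cvgMr.
apply: cvg_sumr => k; apply: cvgMr; apply: cvgB; last exact: cXs.
by apply: hmean_cvg; [exact: hnode01|exact: pC|exact: pX|exact: pXs|exact: le_XXs|exact: cXs].
Qed.

Lemma qentropy_concave N C D X Y t x : 0 <= t <= 1 ->
  (forall i, posdefmx (C i)) -> (forall i, posdefmx (D i)) -> posdefmx X -> posdefmx Y ->
  t * qentropy N C X x + (1 - t) * qentropy N D Y x <=
  qentropy N (fun i => t%:C *: C i + (1 - t)%:C *: D i) (t%:C *: X + (1 - t)%:C *: Y) x.
Proof.
move=> t01 pC pD pX pY; rewrite /qentropy !mulr_sumr -big_split/=; apply: ler_sum => i _.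
rewrite !(mulrCA _ (w i)) -mulrDr ler_wpM2l ?weight_ge0// !mulr_sumr -big_split/=.
apply: ler_sum => k _; rewrite !(mulrCA _ (hweight _ _)) -mulrDr ler_wpM2l ?hweight_ge0//.
have := hmean_concave x (hnode01 (ltn_ord k)) t01 pX pY (pC i) (pD i).
by rewrite !qfD !qfZ => h; rewrite !mulrBr addrACA -opprD lerD2r.
Qed.

Lemma posdef_ge M Z : M^t* = M -> posdefmx Z -> (forall x, qf Z x <= qf M x) -> posdefmx M.
Proof.
move=> hM /posdefP[_ pZ] ZM; apply/posdefP; split=> // x x0.
exact: lt_le_trans (pZ x x0) (ZM x).
Qed.

(** The iterates of the monotone map [hstep N C] starting from an upper bound [B] of the
    [C i] decrease and stay above every [Y <= B] with [Y <= hstep N C Y].  The point [Z]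
    keeps the limit positive definite. *)
Lemma greatest_fixpoint N C B Z : (0 < N)%N -> (forall i, posdefmx (C i)) ->
  posdefmx B -> (forall i x, qf (C i) x <= qf B x) ->
  posdefmx Z -> (forall x, qf Z x <= qf B x) -> (forall x, 0 <= qentropy N C Z x) ->
  exists X, [/\ posdefmx X, forall x, qentropy N C X x = 0, forall x, qf X x <= qf B x &
   forall Y, posdefmx Y -> (forall x, qf Y x <= qf B x) -> (forall x, 0 <= qentropy N C Y x) ->
     forall x, qf Y x <= qf X x].
Proof.
move=> N0 pC pB CB pZ ZB eZ; have c0 := hweight_total_gt0 N0.
pose I k := iter k (hstep N C) B.
have inv k : [/\ posdefmx (I k), forall x, qf (I k.+1) x <= qf (I k) x &
   forall Y, posdefmx Y -> (forall x, qf Y x <= qf B x) -> (forall x, 0 <= qentropy N C Y x) ->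
     forall x, qf Y x <= qf (I k) x].
  (* [dI] is part of the induction because monotonicity turns it into the next one; it
     starts from [hstep N C B <= B], the harmonic mean of [B] and [C i <= B] being
     below [B]. *)
  elim: k => [|k [pI dI YI]].
    split; [exact: pB| |by move=> Y _ YB _ x; exact: YB].
    move=> x; rewrite /I/= qf_hstep// gerDl.
    rewrite pmulr_lle0 ?invr_gt0// /qentropy sumr_le0// => i _.
    rewrite mulr_ge0_le0 ?weight_ge0// sumr_le0// => k _; rewrite mulr_ge0_le0 ?hweight_ge0//.
    rewrite subr_le0 -{2}(hmeanxx (hnode N k) (posdef_unit pB)).
    exact: (hmean_mono x (hnode01 (ltn_ord k)) pB (pC i) pB pB (fun y => lexx _) (CB i)).
  have YI' Y : posdefmx Y -> (forall x, qf Y x <= qf B x) -> (forall x, 0 <= qentropy N C Y x) ->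
     forall x, qf Y x <= qf (I k.+1) x.
    move=> pY YB eY x; apply: le_trans (hstep_mono N x pC pY pI (YI Y pY YB eY)).
    by move: x; apply/qentropy_ge0_hstep.
  have pI' : posdefmx (I k.+1) by apply: posdef_ge (YI' Z pZ ZB eZ) => //; exact: hstep_herm.
  split; [exact: pI'|move=> x; exact: (hstep_mono N x pC pI' pI dI)|exact: YI'].
have [|||X [hX cX XI]] := @decreasing_herm_limit _ _ I Z.
- by move=> k; have [/posdef_herm] := inv k.
- by move=> k x; have [_ ->] := inv k.
- by move=> k x; have [_ _ ->] := inv k.
have YX Y : posdefmx Y -> (forall x, qf Y x <= qf B x) -> (forall x, 0 <= qentropy N C Y x) ->
     forall x, qf Y x <= qf X x.
  by move=> pY YB eY x; apply: cvg_ge_const (cX x) _ => k; have [_ _ ->] := inv k.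
have pX : posdefmx X by apply: posdef_ge (YX Z pZ ZB eZ).
exists X; split; [exact: pX| | |exact: YX].
(* Successive iterates differ by the entropy up to a positive factor, so that the entropy
   tends to zero along them. *)
- move=> x; have ce : qentropy N C (I k) x @[k --> \oo] --> qentropy N C X x.
    by apply: qentropy_cvg; [exact: pC|exact: pX|move=> k; have [] := inv k|exact: XI|exact: cX].
  apply: cvg_unique ce _ => //.
  have -> : (fun k => qentropy N C (I k) x) = (fun k => hweight_total N * (qf (I k.+1) x - qf (I k) x)).
    by apply/funext => k; rewrite /I/= qf_hstep// addrC addKr mulrCA divff ?mulr1// gt_eqF.
  have <- : hweight_total N * (qf X x - qf X x) = 0 by rewrite subrr mulr0.
  apply: cvgMr; apply: cvgB => //.
  by have := cX x; rewrite -cvg_shiftS.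
- by move=> x; exact: (XI 0%N).
Qed.

End Approximation.

(** * Solutions of the Karcher equation *)

Section Existence.
Context {R : realType} {m n : nat}.
Implicit Types (M X Y Z : 'M[R[i]]_m) (x y : 'cV[R[i]]_m) (C D : 'I_n -> 'M[R[i]]_m).
Variable w : 'I_n -> R.
Hypothesis ww : weight w.

(** In a simultaneous diagonalization any number above all the [d i] is a bound, and
    their sum plus one is also positive in dimension zero. *)
Lemma posdef_dominated (X C : 'M[R[i]]_m) : posdefmx X -> posdefmx C ->
  exists2 k : R, 0 < k & forall x, qf C x <= k * qf X x.
Proof.
move=> pX pC; have [S [d jd]] := jdiag_exists pX pC; have [_ d0 _ _] := jd.
have s0 : 0 <= \sum_i d i by apply: sumr_ge0 => i _; exact: ltW.
exists (1 + \sum_i d i); first exact: ltr_pwDl.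
move=> x; rewrite (jdiag_qfC jd) (jdiag_qfX jd) mulr_sumr; apply: ler_sum => i _.
apply: ler_wpM2r; first exact: sqnorm_ge0.
rewrite (bigD1 i)//= addrCA lerDl addr_ge0//; apply: sumr_ge0 => j _; exact: ltW.
Qed.

Lemma posdef_dominated_family (F G : 'I_n -> 'M[R[i]]_m) : (forall i, posdefmx (F i)) ->
  (forall i, posdefmx (G i)) ->
  exists2 k : R, 0 < k & forall i x, qf (F i) x <= k * qf (G i) x.
Proof.
move=> pF pG.
have /choice [k kP] i : exists k : R, 0 < k /\ forall x, qf (F i) x <= k * qf (G i) x.
  by have [k k0 h] := posdef_dominated (pG i) (pF i); exists k.
have s0 : 0 <= \sum_i k i by apply: sumr_ge0 => i _; apply: ltW; have [] := kP i.
exists (1 + \sum_i k i); first exact: ltr_pwDl.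
move=> i x; have [k0 /(_ x) h] := kP i; apply: le_trans h _.
apply: ler_wpM2r; first exact: (posdef_ge0 x (pG i)).
rewrite (bigD1 i)//= addrCA lerDl addr_ge0//; apply: sumr_ge0 => j _.
by apply: ltW; have [] := kP j.
Qed.

(** Test the inequality at the vector whose image under [S*] is the [i]-th basis
    vector. *)
Lemma jdiag_lower (X C S : 'M[R[i]]_m) d (k : R) : jdiag X C S d ->
  (forall x, qf X x <= k * qf C x) -> forall i, 1 <= k * d i.
Proof.
move=> jd XC i; have [x xE] := jdiag_solve jd (delta_mx i 0).
have := XC x; rewrite (jdiag_qfC jd) (jdiag_qfX jd) xE.
have s1 : sqnorm (1 : R[i]) = 1 by rewrite /sqnorm /= expr1n expr0n addr0.
have s0 : sqnorm (0 : R[i]) = 0 by rewrite /sqnorm /= expr0n addr0.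
rewrite (bigD1 i)//= big1 => [|j ji]; last by rewrite !mxE (negbTE ji).
rewrite (bigD1 i)//= big1 => [|j ji]; last by rewrite !mxE (negbTE ji) s0 mulr0.
by rewrite !mxE !eqxx s1 !addr0 mulr1.
Qed.

Section Diagonal.
Variables (C : 'I_n -> 'M[R[i]]_m) (X : 'M[R[i]]_m).
Variables (S : 'I_n -> 'M[R[i]]_m) (d : 'I_n -> 'I_m -> R).
Hypothesis jd : forall i, jdiag X (C i) (S i) (d i).

Let d0 i j : 0 < d i j.
Proof. by have [_ h _ _] := jd i. Qed.

(** The form of [sum_i w_i S_i f(d_i) S_i*]; for [f = ln] it is the weighted relative
    entropy itself. *)
Definition diagsum (f : R -> R) x : R :=
  \sum_i w i * \sum_j f (d i j) * sqnorm (((S i)^t* *m x) j 0).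

Lemma diagsum_le f g x : (forall i j, f (d i j) <= g (d i j)) ->
  diagsum f x <= diagsum g x.
Proof.
move=> fg; apply: ler_sum => i _; apply: ler_wpM2l; first exact: (weight_ge0 ww).
by apply: ler_sum => j _; apply: ler_wpM2r; rewrite ?sqnorm_ge0.
Qed.

Lemma diagsumD f g x : diagsum (fun t => f t + g t) x = diagsum f x + diagsum g x.
Proof.
rewrite -big_split/=; apply: eq_bigr => i _; rewrite -mulrDr; congr (_ * _).
by rewrite -big_split/=; apply: eq_bigr => j _; rewrite mulrDl.
Qed.

Lemma diagsumZ a f x : diagsum (fun t => f t * a) x = diagsum f x * a.
Proof.
rewrite mulr_suml; apply: eq_bigr => i _; rewrite -mulrA; congr (_ * _).
by rewrite mulr_suml; apply: eq_bigr => j _; rewrite mulrAC.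
Qed.

Lemma qentropy_diagsum N x : qentropy w N C X x = diagsum (riemann_log N) x.
Proof.
apply: eq_bigr => i _; congr (_ * _).
transitivity (\sum_(k < N) \sum_j hweight N k * (hfun (hnode N k) (d i j) - 1) *
    sqnorm (((S i)^t* *m x) j 0)).
  apply: eq_bigr => k _; rewrite (hmean_qf _ (hnode01 (ltn_ord k)) (jd i)) (jdiag_qfX (jd i)).
  rewrite -sumrB mulr_sumr; apply: eq_bigr => j _.
  by rewrite -mulrA mulrBl mul1r.
by rewrite exchange_big/=; apply: eq_bigr => j _; rewrite mulr_suml.
Qed.

Lemma diagsum_ln_le N x : (0 < N)%N -> diagsum (@ln R) x <= qentropy w N C X x.
Proof.
by move=> N0; rewrite qentropy_diagsum; apply: diagsum_le => i j; exact: ln_le_riemann_log.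
Qed.

Lemma qentropy_double N x : (0 < N)%N -> qentropy w N.*2 C X x <= qentropy w N C X x.
Proof.
by move=> N0; rewrite !qentropy_diagsum; apply: diagsum_le => i j; exact: riemann_log_double.
Qed.

Lemma qentropy_le_diagsum k N x : (0 < N)%N ->
  (forall i x, qf X x <= k * qf (C i) x) ->
  qentropy w N C X x <= diagsum (@ln R) x + (\sum_i w i * (qf (C i) x + k * qf X x)) / N%:R.
Proof.
move=> N0 XC.
have -> : \sum_i w i * (qf (C i) x + k * qf X x) = diagsum (fun t => t + k) x.
  apply: eq_bigr => i _; congr (_ * _).
  rewrite (jdiag_qfC (jd i)) (jdiag_qfX (jd i)) mulr_sumr -big_split/=.
  by apply: eq_bigr => j _; rewrite mulrDl.
rewrite qentropy_diagsum -diagsumZ -diagsumD; apply: diagsum_le => i j.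
apply: le_trans (riemann_log_le_ln (d0 i j) N0) _; rewrite lerD2l.
apply: ler_wpM2r; first by rewrite invr_ge0.
have h := jdiag_lower (jd i) (XC i) j.
have h2 : (d i j)^-1 <= k by rewrite -[_^-1]mul1r ler_pdivrMr ?d0.
by rewrite -subr_ge0 in h2; rewrite -subr_ge0; move: (d i j) (d i j)^-1 h2 => a b h2; lra.
Qed.

End Diagonal.

(** All approximations agree up to an error of order [1 / M] that is controlled by the
    forms of [X] and the [C i], as each is squeezed between the entropy and the entropy
    plus such an error. *)
Lemma qentropy_compare C X (k : R) (N M : nat) x : posdefmx X -> (forall i, posdefmx (C i)) ->
  (0 < N)%N -> (0 < M)%N -> (forall i x, qf X x <= k * qf (C i) x) ->
  qentropy w M C X x <= qentropy w N C X x + (\sum_i w i * (qf (C i) x + k * qf X x)) / M%:R.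
Proof.
move=> pX pC N0 M0 XC.
have /choice [S /choice [d jd]] : forall i, exists S d, jdiag X (C i) S d.
  by move=> i; exact: (jdiag_exists pX (pC i)).
apply: le_trans (qentropy_le_diagsum jd x M0 XC) _; rewrite lerD2r.
exact: diagsum_ln_le.
Qed.

(** Stated for every choice of simultaneous diagonalizations, which avoids showing that
    the matrix [S (ln d) S*] is independent of the choice. *)
Definition karcher C X := forall (S : 'I_n -> 'M[R[i]]_m) (d : 'I_n -> 'I_m -> R),
  (forall i, jdiag X (C i) (S i) (d i)) -> forall x, diagsum S d (@ln R) x = 0.

(** Let [Xs k] be the greatest fixed point for [N = 2 ^ k].  Its approximate
    entropy is nonnegative for every coarser mesh as well, so [Xs] decreases, and it
    stays above [Z].  For [l >= k] the
    [2 ^ k]-th approximate entropy of [Xs l] is nonnegative and of order [1 / 2 ^ k];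
    both bounds pass to the limit [l -> oo], and then [k -> oo] gives the Karcher
    equation. *)
Lemma karcher_exists C Z : (forall i, posdefmx (C i)) -> posdefmx Z ->
  (forall k x, 0 <= qentropy w (2 ^ k) C Z x) ->
  exists X, [/\ posdefmx X, forall x, qf Z x <= qf X x,
    forall k x, 0 <= qentropy w (2 ^ k) C X x & karcher C X].
Proof.
move=> pC pZ eZ.
have pos2 k : (0 < 2 ^ k)%N by rewrite expn_gt0.
have p1 : posdefmx (1%:M : 'M[R[i]]_m) by rewrite -rdiag1; apply: posdef_rdiag => i.
(* The common upper bound [B] from which all the iterations start. *)
have [a a0 Ca] := posdef_dominated_family pC (fun=> p1).
have [b b0 Zb] := posdef_dominated p1 pZ.
pose B : 'M[R[i]]_m := rdiag (fun=> a + b).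
have qB x : qf B x = (a + b) * qf 1%:M x by exact: qf_rdiag_cst.
have pB : posdefmx B by apply: posdef_rdiag => i; exact: addr_gt0.
have q1 x : 0 <= qf (1%:M : 'M[R[i]]_m) x by exact: posdef_ge0.
have CB i x : qf (C i) x <= qf B x.
  rewrite qB mulrDl; apply: le_trans (Ca i x) _; rewrite lerDl mulr_ge0// ltW//.
have ZB x : qf Z x <= qf B x.
  rewrite qB mulrDl; apply: le_trans (Zb x) _; rewrite lerDr mulr_ge0// ltW//.
have [c c0 Bc] := posdef_dominated_family (fun=> pB) pC.
have /choice [Xs XsP] k := greatest_fixpoint ww (pos2 k) pC pB CB pZ ZB (eZ k).
have pXs k : posdefmx (Xs k) by have [] := XsP k.
have XsB k x : qf (Xs k) x <= qf B x by have [_ _ ->] := XsP k.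
have Xs0 k x : qentropy w (2 ^ k) C (Xs k) x = 0 by have [_ ->] := XsP k.
have ZXs k x : qf Z x <= qf (Xs k) x.
  by have [_ _ _ h] := XsP k; exact: (h Z pZ ZB (eZ k)).
have double k Y x : posdefmx Y -> qentropy w (2 ^ k.+1) C Y x <= qentropy w (2 ^ k) C Y x.
  move=> pY; have /choice [S /choice [d jd]] : forall i, exists S d, jdiag Y (C i) S d.
    by move=> i; exact: (jdiag_exists pY (pC i)).
  by rewrite expnS mul2n; exact: (qentropy_double jd).
(* [Xs (k + l)] solves the equation of the mesh [2 ^ (k + l)], and the approximate entropy
   grows when the mesh is made coarser. *)
have shift k l x : 0 <= qentropy w (2 ^ k) C (Xs (k + l)%N) x.
  elim: l k => [|l IH] k; first by rewrite addn0 Xs0.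
  by rewrite addnS -addSn; apply: le_trans (IH k.+1) (double _ _ _ (pXs _)).
have decr k x : qf (Xs k.+1) x <= qf (Xs k) x.
  have [_ _ _ h] := XsP k; apply: (h (Xs k.+1) (pXs _) (XsB _)) => y.
  by rewrite -(addn1 k); exact: shift.
have [X [hX cX XXs]] := @decreasing_herm_limit _ _ Xs Z (fun k => posdef_herm (pXs k)) decr ZXs.
have ZX x : qf Z x <= qf X x.
  by apply: (cvg_ge_const (cX x)) => k; exact: ZXs.
have pX : posdefmx X by apply: (posdef_ge hX pZ ZX).
(* The error bound must be uniform in [l], whence [B] in place of [Xs (k + l)]. *)
pose K x := \sum_i w i * (qf (C i) x + c * qf B x).
have bound k x : qentropy w (2 ^ k) C X x <= K x / (2 ^ k)%:R /\ 0 <= qentropy w (2 ^ k) C X x.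
  have ce : qentropy w (2 ^ k) C (Xs (k + l)%N) x @[l --> \oo] --> qentropy w (2 ^ k) C X x.
    apply: qentropy_cvg; [exact: pC|exact: pX|move=> l; exact: pXs|move=> l; exact: XXs|].
    move=> y; exact: (cvg_shiftl k (cX y)).
  split; last by apply: (cvg_ge_const ce) => l; exact: shift.
  apply: (cvg_le_const ce) => l.
  have XC i y : qf (Xs (k + l)%N) y <= c * qf (C i) y.
    exact: le_trans (XsB _ _) (Bc i y).
  apply: le_trans (qentropy_compare x (pXs _) pC (pos2 (k + l)%N) (pos2 k) XC) _.
  rewrite Xs0 add0r; apply: ler_wpM2r; first by rewrite invr_ge0.
  apply: ler_sum => i _; apply: ler_wpM2l; first exact: (weight_ge0 ww).
  by rewrite lerD2l; apply: ler_wpM2l; [exact: ltW|exact: XsB].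
exists X; split; [exact: pX|exact: ZX|by move=> k x; have [] := bound k x|].
move=> S d jd x; apply/eqP; rewrite eq_le; apply/andP; split.
  apply: (@le0_of_le_div_exp2 _ _ (K x)) => k; have [h _] := bound k x.
  exact: le_trans (diagsum_ln_le jd x (pos2 k)) h.
rewrite -oppr_le0; apply: (@le0_of_le_div_exp2 _ _ (K x)) => k.
have XC i y : qf X y <= c * qf (C i) y.
  by apply: le_trans (XXs 0%N y) _; exact: le_trans (XsB _ _) (Bc i y).
have [_ h] := bound k x; have h2 := le_trans h (qentropy_le_diagsum jd x (pos2 k) XC).
rewrite -subr_le0 -opprD oppr_le0; apply: le_trans h2 _; rewrite lerD2l.
apply: ler_wpM2r; first by rewrite invr_ge0.
apply: ler_sum => i _; apply: ler_wpM2l; first exact: (weight_ge0 ww).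
rewrite lerD2l; apply: ler_wpM2l; first exact: ltW.
exact: le_trans (XXs 0%N x) (XsB _ _).
Qed.

End Existence.

(** * Scalar estimates for the exponential *)

Section ScalarBounds.
Context {R : realType}.
Implicit Types u v : R.

(** Both this bound and the next come from
    [e^v + e^-v - 2 = e^-v (e^v - 1) ^ 2] and [v <= e^v - 1 <= v e^v] for [v >= 0]. *)
Lemma sqr_expm_le v : (expR v + expR (- v) - 2) <= v ^+ 2 * expR `|v|.
Proof.
wlog v0 : v / 0 <= v => [H|].
  have [|/ltW vN] := leP 0 v; first exact: H.
  by have := H (- v); rewrite opprK oppr_ge0 normrN sqrrN => /(_ vN); rewrite (addrC (expR v)).
rewrite ger0_norm//.
have e0 := expR_gt0 v; have n0 := expR_gt0 (- v).
have E : expR v * expR (- v) = 1 by rewrite -expRD subrr expR0.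
have h1 := expR_ge1Dx (- v).
have h2 := expR_ge1Dx v.
have -> : expR v + expR (- v) - 2 = expR (- v) * (expR v - 1) ^+ 2.
  move: E; move: (expR v) (expR (- v)) => a b E.
  by rewrite [RHS](_ : _ = a * (a * b) - 2 * (a * b) + b); [rewrite E; ring|ring].
have h3 : expR v - 1 <= v * expR v.
  rewrite -subr_ge0 (_ : _ - _ = expR v * (expR (- v) - (1 - v))); last first.
    by rewrite mulrBr E; ring.
  by rewrite mulr_ge0 ?expR_ge0// subr_ge0.
apply: le_trans (_ : expR (- v) * (v * expR v) ^+ 2 <= _).
  rewrite ler_wpM2l ?expR_ge0// ler_sqr ?nnegrE ?mulr_ge0 ?expR_ge0//.
  by rewrite subr_ge0; lra.
have -> : expR (- v) * (v * expR v) ^+ 2 = v ^+ 2 * expR v * (expR v * expR (- v)) by ring.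
by rewrite E mulr1.
Qed.

Lemma sqr_expm_ge v : v ^+ 2 * expR (- `|v|) <= expR v + expR (- v) - 2.
Proof.
wlog v0 : v / 0 <= v => [H|].
  have [|/ltW vN] := leP 0 v; first exact: H.
  by have := H (- v); rewrite opprK oppr_ge0 normrN sqrrN => /(_ vN); rewrite (addrC (expR v)).
rewrite ger0_norm//.
have E : expR v * expR (- v) = 1 by rewrite -expRD subrr expR0.
have h2 := expR_ge1Dx v.
have -> : expR v + expR (- v) - 2 = (expR v - 1) ^+ 2 * expR (- v).
  move: E; move: (expR v) (expR (- v)) => a b E.
  by rewrite [RHS](_ : _ = a * (a * b) - 2 * (a * b) + b); [rewrite E; ring|ring].
rewrite ler_wpM2r ?expR_ge0// ler_sqr ?nnegrE//; lra.
Qed.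

Lemma expR_shrink_cvg (a v : R) :
  a * expR (v / k.+1%:R) @[k --> \oo] --> a.
Proof.
rewrite -[X in _ --> X]mulr1 -[X in _ * X]expR0.
apply: cvgMr; apply: (continuous_cvg _ (@continuous_expR R 0)).
rewrite -(mulr0 v); apply: cvgMr; exact: cvg_harmonic.
Qed.

(** The function [phi u = e^u + e^-u - 2] satisfies
    [phi u = phi (u / 2) (phi (u / 2) + 4) >= 4 phi (u / 2)], so that the local bound
    [sqr_expm_ge] at [v / 2 ^ k] transfers to [v], with an error factor that tends
    to one. *)
Lemma sqr_le_cosh v : v ^+ 2 <= expR v + expR (- v) - 2.
Proof.
pose phi u := expR u + expR (- u) - 2 : R.
have phi0 u : 0 <= phi u.
  by apply: le_trans (sqr_expm_ge u); rewrite mulr_ge0 ?sqr_ge0 ?expR_ge0.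
have half u : 4 * phi (u / 2) <= phi u.
  have E : expR (u / 2) * expR (- (u / 2)) = 1 by rewrite -expRD subrr expR0.
  have e1 : expR u = expR (u / 2) ^+ 2 by rewrite -expRM_natl; congr expR; field.
  have e2 : expR (- u) = expR (- (u / 2)) ^+ 2 by rewrite -expRM_natl; congr expR; field.
  have := sqr_ge0 (phi (u / 2)); rewrite /phi e1 e2.
  move: (expR (u / 2)) (expR (- (u / 2))) E => a b E h; rewrite -subr_ge0.
  apply: le_trans h _; rewrite le_eqVlt; apply/orP; left; apply/eqP.
  by rewrite [LHS](_ : _ = a ^+ 2 + b ^+ 2 + 2 * (a * b) - 4 * (a + b) + 4); [rewrite E; ring|ring].
have iter k : v ^+ 2 * expR (- `|v| / 2 ^+ k) <= phi v.
  apply: le_trans (_ : 4 ^+ k * phi (v / 2 ^+ k) <= _); last first.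
    elim: k => [|k IH]; first by rewrite expr0 mul1r divr1.
    apply: le_trans IH; rewrite exprSr -mulrA ler_wpM2l ?exprn_ge0//.
    by apply: le_trans (half _); rewrite exprSr invfM mulrA.
  have := sqr_expm_ge (v / 2 ^+ k).
  rewrite normrM normfV (ger0_norm (exprn_ge0 _ _))// mulNr => h.
  have p4 : 0 <= 4 ^+ k :> R by rewrite exprn_ge0.
  have := ler_wpM2l p4 h; apply: le_trans.
  rewrite expr_div_n mulrA mulrCA (_ : 4 ^+ k = 2 ^+ k ^+ 2 :> R); last first.
    by rewrite -exprM mulnC exprM; congr (_ ^+ _); ring.
  by rewrite mulfV ?mulr1// !expf_neq0// pnatr_eq0.
have c := @expR_shrink_cvg (v ^+ 2) (- `|v|).
apply: (cvg_le_const c) => k; apply: le_trans (iter k); rewrite ler_wpM2l ?sqr_ge0//.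
rewrite ler_expR !mulNr lerN2 ler_wpM2l// lef_pV2 ?posrE ?exprn_gt0//.
by rewrite -natrX ler_nat ltn_expl.
Qed.

Lemma sqr_sum_le (N : nat) (a : nat -> R) :
  (\sum_(k < N) a k) ^+ 2 <= N%:R * \sum_(k < N) a k ^+ 2.
Proof.
elim: N => [|N IH]; first by rewrite !big_ord0 expr0n mulr0.
rewrite !big_ord_recr/=; move: IH.
set s := \sum_(k < N) a k; set q := \sum_(k < N) a k ^+ 2; move: (a N) => b IH.
have [N0|N0] := posnP N.
  have -> : s = 0 by rewrite /s N0 big_ord0.
  have -> : q = 0 by rewrite /q N0 big_ord0.
  by rewrite N0 !add0r mul1r.
have N0' : (0 : R) < N%:R by rewrite ltr0n.
suff : 2 * s * b <= q + N%:R * b ^+ 2.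
  by rewrite -[N.+1]addn1 natrD => h; nra.
rewrite -(ler_pM2l N0').
have := sqr_ge0 (s - N%:R * b); nra.
Qed.

End ScalarBounds.

(** * The Frobenius norm and the matrix logarithm *)

Section Frobenius.
Context {R : realType} {m : nat}.
Implicit Types (A B M K U V : 'M[R[i]]_m) (x y : 'cV[R[i]]_m).

Definition fnorm2 M : R := \sum_i \sum_j sqnorm (M i j).
Definition fdot A B : R := \sum_i \sum_j
  (complex.Re (A i j) * complex.Re (B i j) + complex.Im (A i j) * complex.Im (B i j)).

Lemma fnorm2_ge0 M : 0 <= fnorm2 M.
Proof. by apply: sumr_ge0 => i _; apply: sumr_ge0 => j _; exact: sqnorm_ge0. Qed.

Lemma Re_tr (T : 'M[R[i]]_m) : complex.Re (\tr T) = \sum_i complex.Re (T i i).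
Proof. exact: Re_sum. Qed.

Lemma Re_tr_diag K (f g : 'I_m -> R) :
  complex.Re (\tr (rdiag f *m K *m rdiag g *m K^t*)) =
  \sum_i \sum_j f i * g j * sqnorm (K i j).
Proof.
rewrite Re_tr; apply: eq_bigr => i _; rewrite mxE Re_sum; apply: eq_bigr => j _.
rewrite mul_mx_diag mxE mul_diag_mx !mxE.
have -> : ((f i)%:C * K i j * (g j)%:C * (K i j)^* = (f i)%:C * (g j)%:C * ((K i j)^* * K i j))%R by ring.
by rewrite conjM_sqnorm -!rmorphM.
Qed.

Lemma fnorm2_tr M : fnorm2 M = complex.Re (\tr (M *m M^t*)).
Proof.
have := Re_tr_diag M (fun=> 1) (fun=> 1); rewrite !rdiag1 mul1mx mulmx1 => ->.
by apply: eq_bigr => i _; apply: eq_bigr => j _; rewrite !mul1r.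
Qed.

Lemma fnorm2_unitary U V M : U^t* *m U = 1%:M -> V *m V^t* = 1%:M ->
  fnorm2 (U *m M *m V) = fnorm2 M.
Proof.
move=> UU VV; rewrite !fnorm2_tr !trmxCM.
have -> : U *m M *m V *m (V^t* *m (M^t* *m U^t*)) = U *m (M *m M^t* *m U^t*).
  by rewrite !mulmxA -(mulmxA (U *m M) V) VV mulmx1.
by rewrite mxtrace_mulC -!mulmxA UU mulmx1.
Qed.

Lemma fnorm2_rdiag (f : 'I_m -> R) : fnorm2 (rdiag f) = \sum_i f i ^+ 2.
Proof.
apply: eq_bigr => i _; rewrite (bigD1 i)//= big1 => [|j ji]; rewrite !mxE.
  by rewrite eqxx /= /sqnorm /= expr0n !addr0.
by rewrite eq_sym (negbTE ji) /sqnorm /= expr0n addr0.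
Qed.

Lemma fnorm2B A B : fnorm2 (A - B) = fnorm2 A - 2 * fdot A B + fnorm2 B.
Proof.
rewrite /fnorm2 /fdot mulr_sumr -sumrB -big_split/=; apply: eq_bigr => i _.
rewrite mulr_sumr -sumrB -big_split/=; apply: eq_bigr => j _.
rewrite !mxE; case: (A i j) => a b; case: (B i j) => c d; rewrite /sqnorm /=; ring.
Qed.

Lemma fdot0 A : fdot A 0 = 0.
Proof.
by rewrite /fdot big1 // => i _; rewrite big1 // => j _; rewrite mxE /= !mulr0 addr0.
Qed.

Lemma fdot_sum A n (w : 'I_n -> R) (Hs : 'I_n -> 'M[R[i]]_m) :
  fdot A (\sum_k (w k)%:C *: Hs k) = \sum_k w k * fdot A (Hs k).
Proof.
under [RHS]eq_bigr do rewrite mulr_sumr; rewrite exchange_big/=.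
apply: eq_bigr => i _; under [RHS]eq_bigr do rewrite mulr_sumr; rewrite exchange_big/=.
apply: eq_bigr => j _.
have -> : (\sum_k (w k)%:C *: Hs k) i j =
    Complex (\sum_k w k * complex.Re (Hs k i j)) (\sum_k w k * complex.Im (Hs k i j)).
  rewrite summxE; elim/big_rec3: _ => //= k a b c _ ->.
  by rewrite mxE; case: (Hs k i j) => p q; apply/eqP; rewrite eq_complex /= !mul0r subr0 addr0 !eqxx.
rewrite /= !mulr_sumr -big_split/=; apply: eq_bigr => k _; ring.
Qed.

(** The variance identity in the Euclidean space of matrices: when the weighted mean of
    the [Hs k] is zero, the mean square distance to [A] exceeds the one to zero by
    exactly the square norm of [A]. *)
Lemma fnorm2_variance A n (w : 'I_n -> R) (Hs : 'I_n -> 'M[R[i]]_m) : \sum_k w k = 1 ->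
  \sum_k w k * fnorm2 (A - Hs k) =
  fnorm2 A - 2 * fdot A (\sum_k (w k)%:C *: Hs k) + \sum_k w k * fnorm2 (Hs k).
Proof.
move=> w1; have -> : fnorm2 A = \sum_k w k * fnorm2 A by rewrite -mulr_suml w1 mul1r.
rewrite fdot_sum mulr_sumr.
rewrite -sumrB -big_split; apply: eq_bigr => k _; rewrite fnorm2B /=.
by move: (fnorm2 A) (fdot A (Hs k)) (fnorm2 (Hs k)) => a b c; ring.
Qed.

Lemma fnorm2_sum_le (N : nat) (F : nat -> 'M[R[i]]_m) :
  fnorm2 (\sum_(k < N) F k) <= N%:R * \sum_(k < N) fnorm2 (F k).
Proof.
rewrite exchange_big mulr_sumr; apply: ler_sum => i _.
rewrite exchange_big mulr_sumr; apply: ler_sum => j _.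
have -> : (\sum_(k < N) F k) i j =
    Complex (\sum_(k < N) complex.Re (F k i j)) (\sum_(k < N) complex.Im (F k i j)).
  rewrite summxE; elim/big_rec3: _ => //= k a b c _ ->.
  by case: (F k i j).
rewrite /sqnorm /= big_split/= mulrDr.
by apply: lerD; [exact: (sqr_sum_le N (fun k => complex.Re (F k i j)))|
  exact: (sqr_sum_le N (fun k => complex.Im (F k i j)))].
Qed.

Definition hlog M : 'M[R[i]]_m :=
  eigvecs M *m rdiag (fun i => ln (eigvals M i)) *m (eigvecs M)^t*.

Lemma conj_mul U A B : U^t* *m U = 1%:M ->
  (U *m A *m U^t*) *m (U *m B *m U^t*) = U *m (A *m B) *m U^t*.
Proof. by move=> U1; rewrite !mulmxA -(mulmxA (U *m A) (U^t*) U) U1 mulmx1. Qed.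

Lemma invmx_spectral M : posdefmx M ->
  invmx M = eigvecs M *m rdiag (fun i => (eigvals M i)^-1) *m (eigvecs M)^t*.
Proof.
move=> pM; have [U1 U2] := eigvecs_unitary M.
apply: invmx_uniq; rewrite [X in X *m _](spectral_decomp (posdef_herm pM)).
rewrite (conj_mul _ _ U1) rdiagM.
have -> : rdiag (fun i => eigvals M i * (eigvals M i)^-1) = 1%:M.
  rewrite -rdiag1; apply: rdiag_eq => i.
  by rewrite divff// gt_eqF// (eigvals_gt0 pM).
by rewrite mulmx1.
Qed.

Lemma Re_tr_conj U V (f g : 'I_m -> R) :
  complex.Re (\tr ((U *m rdiag f *m U^t*) *m (V *m rdiag g *m V^t*))) =
  \sum_i \sum_j f i * g j * sqnorm ((U^t* *m V) i j).
Proof.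
rewrite -Re_tr_diag trmxCM trmxCK -!mulmxA mxtrace_mulC.
by rewrite -!mulmxA.
Qed.

(** Expand in eigenbases [U] of [A] and [V] of [B], with [K = U* V]: both sides become
    sums over [i] and [j] with the weights [|K_ij| ^ 2], and are compared term by term by
    [sqr_le_cosh] at [u = ln a_i - ln b_j]. *)
Lemma fnorm2_hlogB A B : posdefmx A -> posdefmx B ->
  fnorm2 (hlog A - hlog B) <=
  complex.Re (\tr (invmx A *m B)) + complex.Re (\tr (invmx B *m A)) - 2 * m%:R.
Proof.
move=> pA pB; have [U1 U2] := eigvecs_unitary A; have [V1 V2] := eigvecs_unitary B.
have a0 := eigvals_gt0 pA; have b0 := eigvals_gt0 pB.
rewrite (mxtrace_mulC (invmx B)) /hlog (invmx_spectral pA) (invmx_spectral pB).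
rewrite [X in \tr (_ *m X)](spectral_decomp (posdef_herm pB)).
rewrite [X in _ + complex.Re (\tr (X *m _))](spectral_decomp (posdef_herm pA)).
move: (eigvecs A) (eigvecs B) (eigvals A) (eigvals B) U1 U2 V1 V2 a0 b0.
move=> U V a b U1 U2 V1 V2 a0 b0.
rewrite (Re_tr_conj U V (fun i => (a i)^-1) b) (Re_tr_conj U V a (fun i => (b i)^-1)).
set K := U^t* *m V.
have m_sum : m%:R = \sum_i \sum_j sqnorm (K i j) :> R.
  have h := Re_tr_conj U V (fun=> 1) (fun=> 1).
  rewrite !rdiag1 !mulmx1 U2 V2 mulmx1 mxtrace1 in h.
  have -> : m%:R = complex.Re (m%:R : R[i]) by rewrite -(rmorph_nat (real_complex R)).
  by rewrite h; apply: eq_bigr => i _; apply: eq_bigr => j _; rewrite !mul1r.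
pose D := rdiag (fun i => ln (a i)) *m K - K *m rdiag (fun i => ln (b i)).
have -> : U *m rdiag (fun i => ln (a i)) *m U^t* - V *m rdiag (fun i => ln (b i)) *m V^t*
    = U *m D *m V^t*.
  rewrite /D mulmxBr mulmxBl /K; congr (_ - _).
    by rewrite !mulmxA -(mulmxA _ V) V2 mulmx1.
  by rewrite !mulmxA U2 mul1mx.
rewrite fnorm2_unitary ?trmxCK// m_sum mulr_sumr -sumrN -!big_split/=.
apply: ler_sum => i _; rewrite mulr_sumr -sumrN -!big_split/=; apply: ler_sum => j _.
have -> : D i j = ((ln (a i) - ln (b j))%:C * K i j)%R.
  rewrite /D mxE [X in _ + X]mxE mul_diag_mx mul_mx_diag !mxE rmorphB mulrBl.
  by congr (_ - _); rewrite mulrC.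
have -> : sqnorm ((ln (a i) - ln (b j))%:C * K i j)%R = (ln (a i) - ln (b j)) ^+ 2 * sqnorm (K i j).
  by case: (K i j) => p q; rewrite /sqnorm /= !mul0r subr0 addr0; ring.
rewrite -mulNr -!mulrDl; apply: ler_wpM2r; first exact: sqnorm_ge0.
apply: le_trans (sqr_le_cosh _) _.
rewrite opprB expRB expRB !lnK ?posrE//.
by rewrite le_eqVlt; apply/orP; left; apply/eqP; ring.
Qed.

End Frobenius.

(** * The exponential metric increasing property *)

Section TraceDistance.
Context {R : realType} {m : nat}.
Implicit Types (A B X Y T S : 'M[R[i]]_m) (d : 'I_m -> R).

Lemma jdiag_invmxM X C S d : jdiag X C S d ->
  invmx X *m C = invmx (S^t*) *m rdiag d *m S^t*.
Proof.
move=> [uS _ -> ->]; have u : S^t* \in unitmx by rewrite map_unitmx unitmx_tr.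
rewrite (invmx_mul uS u) !mulmxA -(mulmxA _ (invmx S) S) (mulVmx uS).
by rewrite mulmx1.
Qed.

Lemma trace_dist_jdiag Y A S d : jdiag Y A S d ->
  trace_dist Y A ^+ 2 = \sum_i ln (d i) ^+ 2.
Proof.
move=> jd; have [uS d0 _ _] := jd.
have u : S^t* \in unitmx by rewrite map_unitmx unitmx_tr.
rewrite /trace_dist sqr_sqrtr; last by apply: sumr_ge0 => z _; exact: sqr_ge0.
have pe : perm_eq (eigenvalues (invmx Y *m A)) [seq (d i)%:C | i <- enum 'I_m].
  apply: prod_XsubC_eq; rewrite -eigenvaluesP (jdiag_invmxM jd) char_poly_similar//.
  rewrite char_poly_trig ?diag_mx_is_trig// big_map big_enum/=.
  by apply: eq_bigr => i _; rewrite !mxE eqxx.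
by rewrite (perm_big _ pe) big_map big_enum.
Qed.

Lemma jdiag_congr T X C S d : T \in unitmx -> jdiag X C S d ->
  jdiag (T *m X *m T^t*) (T *m C *m T^t*) (T *m S) d.
Proof.
move=> uT [uS d0 -> ->]; split=> //; first by rewrite unitmx_mul uT.
- by rewrite trmxCM !mulmxA.
- by rewrite trmxCM !mulmxA.
Qed.

(** The trace-metric geodesic from [S S*] (at [s = 0]) to [S (diag d) S*] (at
    [s = 1]). *)
Definition geodesic S d (s : R) : 'M[R[i]]_m :=
  S *m rdiag (fun i => expR (s * ln (d i))) *m S^t*.

Lemma geodesic_posdef S d s : S \in unitmx -> posdefmx (geodesic S d s).
Proof.
move=> uS; apply: (posdef_congr uS); apply: posdef_rdiag => i; exact: expR_gt0.
Qed.

(** The matrix [geodesic s ^-1 geodesic t] is similar to the [t - s] power of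
    [diag d]. *)
Lemma geodesic_tr S d s t : S \in unitmx ->
  complex.Re (\tr (invmx (geodesic S d s) *m geodesic S d t)) =
  \sum_i expR ((t - s) * ln (d i)).
Proof.
move=> uS; have u : S^t* \in unitmx by rewrite map_unitmx unitmx_tr.
have e0 i : expR (s * ln (d i)) != 0 by rewrite gt_eqF ?expR_gt0.
have [uD _] := rdiagV e0.
have -> : geodesic S d t = geodesic S d s *m
    (invmx (S^t*) *m rdiag (fun i => expR ((t - s) * ln (d i))) *m S^t*).
  rewrite /geodesic (mul_conj_inv _ _ _ u) rdiagM; congr (_ *m _ *m _); apply: rdiag_eq => i.
  by rewrite -expRD; congr expR; ring.
rewrite (mulKmx (posdef_unit (geodesic_posdef d s uS))).
rewrite mxtrace_mulC mulmxA mulmxV// mul1mx Re_tr; apply: eq_bigr => i _.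
by rewrite !mxE eqxx.
Qed.

Lemma fnorm2_geodesic S d (a b : R) : S \in unitmx ->
  fnorm2 (hlog (geodesic S d a) - hlog (geodesic S d b)) <=
  \sum_i (expR ((b - a) * ln (d i)) + expR (- ((b - a) * ln (d i))) - 2).
Proof.
move=> uS.
have h := fnorm2_hlogB (geodesic_posdef d a uS) (geodesic_posdef d b uS).
rewrite (geodesic_tr d a b uS) (geodesic_tr d b a uS) in h.
rewrite sumrB big_split/= sumr_const card_ord -[2 *+ m]mulr_natr.
under [X in _ + X - _]eq_bigr do rewrite -mulNr opprB.
exact: h.
Qed.

(** Cut the geodesic from [Y] to [A] into [N + 1] equal pieces, apply [fnorm2_hlogB] to
    each, and add up.  As the terms [e^u + e^-u - 2] at [u = ln d_i / (N + 1)] are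
    [u ^ 2] up to a factor tending to one, the limit of the bound is the sum of the
    [(ln d_i) ^ 2]. *)
Lemma exp_metric_increasing Y A : posdefmx Y -> posdefmx A ->
  fnorm2 (hlog Y - hlog A) <= trace_dist Y A ^+ 2.
Proof.
move=> pY pA; have [S [d jd]] := jdiag_exists pY pA.
have [uS d0 eY eA] := jd; rewrite (trace_dist_jdiag jd).
have g0 : geodesic S d 0 = Y.
  rewrite /geodesic (_ : rdiag _ = 1%:M) ?mulmx1// -rdiag1.
  by apply: rdiag_eq => i; rewrite mul0r expR0.
have g1 : geodesic S d 1 = A.
  rewrite eA /geodesic; congr (_ *m _ *m _).
  by apply: rdiag_eq => i; rewrite mul1r lnK ?posrE.
(* Convexity of the square costs a factor [N + 1] and the sum of [N + 1] equal terms
   another one; each term is of order [(N + 1) ^ -2]. *)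
have step (N : nat) : fnorm2 (hlog Y - hlog A) <=
    \sum_i ln (d i) ^+ 2 * expR (`|ln (d i)| / N.+1%:R).
  have N0 : (0 : R) < N.+1%:R by rewrite ltr0n.
  pose G k := hlog (geodesic S d (k%:R / N.+1%:R)).
  have -> : hlog Y - hlog A = \sum_(k < N.+1) (G k - G k.+1).
    rewrite -(big_mkord xpredT (fun k => G k - G k.+1)).
    rewrite (telescope_sumr_eq (fun k => - G k))//; last by move=> k _; rewrite opprK addrC.
    by rewrite /G mul0r divff ?gt_eqF// g0 g1 opprK addrC.
  apply: le_trans (fnorm2_sum_le N.+1 (fun k => G k - G k.+1)) _.
  apply: le_trans (_ : N.+1%:R * \sum_(k < N.+1)
     (\sum_i (expR (ln (d i) / N.+1%:R) + expR (- (ln (d i) / N.+1%:R)) - 2)) <= _).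
    apply: ler_wpM2l; first exact: ltW.
    apply: ler_sum => k _.
    have e : k.+1%:R / N.+1%:R - k%:R / N.+1%:R = N.+1%:R^-1 :> R.
      by rewrite -mulrBl -natrB// subSnn mul1r.
    have := fnorm2_geodesic d (k%:R / N.+1%:R) (k.+1%:R / N.+1%:R) uS.
    by rewrite e; under eq_bigr do rewrite (mulrC _^-1).
  rewrite sumr_const card_ord -[X in _ * X]mulr_natl !mulr_sumr; apply: ler_sum => i _.
  apply: le_trans (_ : N.+1%:R * (N.+1%:R * ((ln (d i) / N.+1%:R) ^+ 2 * expR `|ln (d i) / N.+1%:R|)) <= _).
    by apply: ler_wpM2l; [exact: ltW|apply: ler_wpM2l; [exact: ltW|exact: sqr_expm_le]].
  rewrite normrM normfV (ger0_norm (ltW N0)) le_eqVlt; apply/orP; left; apply/eqP.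
  by move: (expR _) => e; move: (N.+1%:R) N0 => q q0; field; rewrite gt_eqF.
have c : \sum_i ln (d i) ^+ 2 * expR (`|ln (d i)| / N.+1%:R) @[N --> \oo] --> \sum_i ln (d i) ^+ 2.
  by apply: cvg_sumr => i; exact: expR_shrink_cvg.
exact: cvg_ge_const c step.
Qed.

End TraceDistance.

(** * Karcher solutions are the unique minimizers *)

Section Minimizer.
Context {R : realType} {m n : nat}.
Implicit Types (X Y T : 'M[R[i]]_m) (C : 'I_n -> 'M[R[i]]_m).
Variable w : 'I_n -> R.
Hypothesis ww : weight w.

Lemma qf_hlog (M : 'M[R[i]]_m) x :
  qf (hlog M) x = \sum_j ln (eigvals M j) * sqnorm (((eigvecs M)^t* *m x) j 0).
Proof. by rewrite /hlog qf_congr qf_rdiag. Qed.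

Lemma hlog_herm (M : 'M[R[i]]_m) : (hlog M)^t* = hlog M.
Proof. by rewrite /hlog !trmxCM trmxCK rdiag_tr mulmxA. Qed.

Lemma fnorm2_hlog (M : 'M[R[i]]_m) : fnorm2 (hlog M) = \sum_j ln (eigvals M j) ^+ 2.
Proof.
have [U1 U2] := eigvecs_unitary M.
have V1 : (eigvecs M)^t* *m ((eigvecs M)^t*)^t* = 1%:M by rewrite (trmxCK (eigvecs M)); exact: U1.
by rewrite /hlog (fnorm2_unitary _ U1 V1) fnorm2_rdiag.
Qed.

Lemma jdiag_spectral T (M : 'M[R[i]]_m) : T \in unitmx -> posdefmx M ->
  jdiag (T *m T^t*) (T *m M *m T^t*) (T *m eigvecs M) (eigvals M).
Proof.
move=> uT pM; have [U1 U2] := eigvecs_unitary M.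
have j1 : jdiag 1%:M M (eigvecs M) (eigvals M).
  split; [by have [] := mulmx1_unit U2|exact: eigvals_gt0|by rewrite U2|].
  exact: spectral_decomp (posdef_herm pM).
by have := jdiag_congr uT j1; rewrite mulmx1.
Qed.

(** Congruence by a factor [T] of [X = T T*] preserves trace distances and turns the
    Karcher equation into [sum_i w_i log D_i = 0], where [D_i = T^-1 C_i T^-*].  The
    exponential metric increasing property and the variance identity then bound the
    excess cost of [Y] from below by the square norm of the logarithm of
    [T^-1 Y T^-*], which is zero only for [Y = X]. *)
Lemma karcher_cost C X Y : (forall i, posdefmx (C i)) -> posdefmx X -> karcher w C X ->
  posdefmx Y -> lscost w C X <= lscost w C Y /\ (lscost w C Y <= lscost w C X -> Y = X).
Proof.
move=> pC pX kX pY.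
have [T [_ [uT _ XE _]]] := jdiag_exists pX pX.
have uV : invmx T \in unitmx by rewrite unitmx_inv.
(* The congruence that takes [X] to the identity. *)
pose red M : 'M[R[i]]_m := invmx T *m M *m (invmx T)^t*.
have redK M : T *m red M *m T^t* = M.
  rewrite /red !mulmxA (mulmxV uT) mul1mx -mulmxA -trmxCM (mulmxV uT).
  by rewrite trmx1 map_mx1 mulmx1.
have pred M : posdefmx M -> posdefmx (red M) by exact: posdef_congr.
pose D i := red (C i); pose Y' := red Y.
have pD i : posdefmx (D i) by exact: pred (pC i).
have pY' : posdefmx Y' by exact: pred pY.
have jX i : jdiag X (C i) (T *m eigvecs (D i)) (eigvals (D i)).
  by have := jdiag_spectral uT (pD i); rewrite -XE redK.
have sum0 : \sum_i (w i)%:C *: hlog (D i) = 0.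
  apply: herm_qf_inj.
  - by rewrite trmxC_sum; apply: eq_bigr => i _; rewrite trmxCZ hlog_herm.
  - by rewrite trmx0 map_mx0.
  move=> y; have uT' : T^t* \in unitmx by rewrite map_unitmx unitmx_tr.
  have := kX _ _ jX (invmx (T^t*) *m y); rewrite /diagsum => h.
  rewrite qf_sum [RHS]/qf mulmx0 mul0mx mxE -[RHS]h; apply: eq_bigr => i _.
  rewrite qfZ qf_hlog; congr (_ * _); apply: eq_bigr => j _.
  by rewrite trmxCM -mulmxA (mulKVmx uT').
have costX : lscost w C X = \sum_i w i * fnorm2 (hlog (D i)).
  apply: eq_bigr => i _; congr (_ * _).
  by rewrite (trace_dist_jdiag (jX i)) fnorm2_hlog.
have costY : fnorm2 (hlog Y') + lscost w C X <= lscost w C Y.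
  have -> : fnorm2 (hlog Y') + lscost w C X =
      \sum_i w i * fnorm2 (hlog Y' - hlog (D i)).
    by rewrite (fnorm2_variance _ _ ww.2) sum0 fdot0 mulr0 subr0 costX.
  apply: ler_sum => i _; apply: ler_wpM2l; first exact: (weight_ge0 ww).
  have [S [d jd]] := jdiag_exists pY' (pD i).
  have jd' : jdiag Y (C i) (T *m S) d.
    by rewrite -(redK Y) -(redK (C i)); exact: (jdiag_congr uT jd).
  rewrite (etrans (trace_dist_jdiag jd') (esym (trace_dist_jdiag jd))).
  exact: (exp_metric_increasing pY' (pD i)).
have f0 := fnorm2_ge0 (hlog Y').
split; first by apply: le_trans costY; rewrite lerDr.
move=> YX; have fle : fnorm2 (hlog Y') <= 0.
  by rewrite -(lerD2r (lscost w C X)) add0r; exact: le_trans costY YX.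
have /eqP : fnorm2 (hlog Y') = 0 by apply/eqP; rewrite eq_le fle f0.
rewrite fnorm2_hlog psumr_eq0 => [/allP l0|i _]; last exact: sqr_ge0.
have Y'1 : Y' = 1%:M.
  have [U1 U2] := eigvecs_unitary Y'.
  rewrite (spectral_decomp (posdef_herm pY')) (_ : rdiag _ = 1%:M) ?mulmx1//.
  rewrite -rdiag1; apply: rdiag_eq => j.
  have := l0 j (mem_index_enum j); rewrite /= sqrf_eq0 => /eqP e.
  by rewrite -(lnK (eigvals_gt0 pY' j)) e expR0.
by rewrite -(redK Y) -/Y' Y'1 mulmx1 XE.
Qed.

End Minimizer.

(** * Joint concavity *)

Section LeastSquaresMeanBounds.
Context {R : realType} {m n : nat}.
Variable w : 'I_n -> R.
Hypothesis ww : weight w.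

Lemma karcher_lsmean (C : 'I_n -> 'M[R[i]]_m) X : (forall i, posdefmx (C i)) ->
  posdefmx X -> karcher w C X -> lsmean w C = X.
Proof.
move=> pC pX kX.
have [pG minG] : lsminimizers w C (lsmean w C).
  have mX : lsminimizers w C X.
    by split; [exact: pX|move=> Y pY; exact: (karcher_cost ww pC pX kX pY).1].
  exact: (xgetPex 1%:M (ex_intro _ X mX)).
exact: ((karcher_cost ww pC pX kX pG).2 (minG X pX)).
Qed.

(** The comparison principle.  The Karcher solution constructed above [Z] is the mean,
    because the mean is the only minimizer. *)
Lemma lsmean_ge (C : 'I_n -> 'M[R[i]]_m) Z : (forall i, posdefmx (C i)) -> posdefmx Z ->
  (forall k x, 0 <= qentropy w (2 ^ k) C Z x) ->
  [/\ posdefmx (lsmean w C), forall x, qf Z x <= qf (lsmean w C) x &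
      forall k x, 0 <= qentropy w (2 ^ k) C (lsmean w C) x].
Proof.
move=> pC pZ eZ; have [X [pX ZX eX kX]] := karcher_exists ww pC pZ eZ.
by rewrite (karcher_lsmean pC pX kX); split; [exact: pX|exact: ZX|exact: eX].
Qed.

(** The comparison principle applies to a multiple [Z] of the identity below all the
    [C i], as [hmean s Z (C i)] is then at least [hmean s Z Z = Z]. *)
Lemma lsmean_qentropy_ge0 (C : 'I_n -> 'M[R[i]]_m) : (forall i, posdefmx (C i)) ->
  posdefmx (lsmean w C) /\ forall k x, 0 <= qentropy w (2 ^ k) C (lsmean w C) x.
Proof.
move=> pC.
have p1 : posdefmx (1%:M : 'M[R[i]]_m) by rewrite -rdiag1; apply: posdef_rdiag => i.
have [k k0 kP] := posdef_dominated_family (fun=> p1) pC.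
pose Z : 'M[R[i]]_m := rdiag (fun=> k^-1).
have pZ : posdefmx Z by apply: posdef_rdiag => i; rewrite invr_gt0.
have ZC i x : qf Z x <= qf (C i) x by rewrite qf_rdiag_cst ler_pdivrMl.
suff eZ l x : 0 <= qentropy w (2 ^ l) C Z x.
  by have [pG _ eG] := lsmean_ge pC pZ eZ; split; [exact: pG|exact: eG].
apply: sumr_ge0 => i _; apply: mulr_ge0; first exact: (weight_ge0 ww).
apply: sumr_ge0 => j _; apply: mulr_ge0; first exact: hweight_ge0.
rewrite subr_ge0 -{1}(hmeanxx (hnode (2 ^ l) j) (posdef_unit pZ)).
exact: (hmean_mono x (hnode01 (ltn_ord j)) pZ pZ pZ (pC i) (fun y => lexx _) (ZC i)).
Qed.

End LeastSquaresMeanBounds.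

Theorem proposition6p6 (R : realType) (m n : nat) (hn : (2 <= n)%N)
    (w : 'I_n -> R) (hw : weight w)
    (A B : 'I_n -> 'M[R[i]]_m)
    (hA : forall i, posdefmx (A i)) (hB : forall i, posdefmx (B i))
    (t : R) (ht : 0 <= t <= 1) :
  t%:C *: lsmean w A + (1 - t)%:C *: lsmean w B
    <=L lsmean w (fun i => t%:C *: A i + (1 - t)%:C *: B i).
Proof.
have [pGA eA] := lsmean_qentropy_ge0 hw hA; have [pGB eB] := lsmean_qentropy_ge0 hw hB.
set Z := t%:C *: lsmean w A + _.
have pZ : posdefmx Z by exact: (posdef_conv ht pGA pGB).
have pC i : posdefmx (t%:C *: A i + (1 - t)%:C *: B i) by exact: (posdef_conv ht (hA i) (hB i)).
have eZ k x : 0 <= qentropy w (2 ^ k) (fun i => t%:C *: A i + (1 - t)%:C *: B i) Z x.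
  apply: le_trans (qentropy_concave hw _ x ht hA hB pGA pGB).
  by case/andP: ht => t0 t1; apply: addr_ge0; apply: mulr_ge0; rewrite ?subr_ge0.
have [pG ZG _] := lsmean_ge hw pC pZ eZ.
apply/possemidefP; split.
  by rewrite trmxCD trmxCN (posdef_herm pG) (posdef_herm pZ).
by move=> x; rewrite qfB subr_ge0; exact: ZG.
Qed.
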